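(* Let $R$ and $S$ be commutative noetherian rings, let $C$ be a semidualizing $R$-module, let $M$ and $N$ be $R$-modules, and let $R\to S$ be a flat ring homomorphism. Then for all $i$ there are $S$-module isomorphisms $$\operatorname{Tor}^{\mathcal{P}_{S\otimes_R C}\mathcal{M}}_i(S\otimes_R M,S\otimes_R N)\cong S\otimes_R\operatorname{Tor}^{\mathcal{P}_C\mathcal{M}}_i(M,N),$$ $$\operatorname{Tor}^{\mathcal{F}_{S\otimes_R C}\mathcal{M}}_i(S\otimes_R M,S\otimes_R N)\cong S\otimes_R\operatorname{Tor}^{\mathcal{F}_C\mathcal{M}}_i(M,N).$$
   Context: A finitely generated module $C$ over a commutative noetherian ring $R$ is semidualizing if the homothety map $R\to\operatorname{Hom}_R(C,C)$ is an isomorphism and $\operatorname{Ext}^i_R(C,C)=0$ for all $i\geq 1$. If $R\to S$ is flat, then $S\otimes_R C$ is a semidualizing $S$-module. $\mathcal{P}_C(R)$ is the class of $R$-modules isomorphic to $P\otimes_R C$ with $P$ projective, and $\mathcal{F}_C(R)$ is the class of $R$-modules isomorphic to $F\otimes_R C$ with $F$ flat; both are precovering. For a precovering class $\mathcal{X}$, a proper $\mathcal{X}$-resolution of $M$ is a complex $X=(\cdots\to X_1\to X_0\to 0)$ with each $X_i\in\mathcal{X}$ together with an augmentation $X_0\to M$ such that $X^+=(\cdots\to X_1\to X_0\to M\to 0)$ is a complex (not necessarily exact) and $\operatorname{Hom}_R(Y,X^+)$ is exact for all $Y\in\mathcal{X}$. If $Q$ is a proper $\mathcal{P}_C$-resolution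 of $M$ and $G$ is a proper $\mathcal{F}_C$-resolution of $M$, then for $i\geq 0$ $$\operatorname{Tor}^{\mathcal{P}_C\mathcal{M}}_i(M,N):=H_i(Q\otimes_R N),\qquad \operatorname{Tor}^{\mathcal{F}_C\mathcal{M}}_i(M,N):=H_i(G\otimes_R N),$$ independent of the choice of proper resolutions. The functors $\operatorname{Tor}^{\mathcal{P}_{S\otimes_R C}\mathcal{M}}_i$ and $\operatorname{Tor}^{\mathcal{F}_{S\otimes_R C}\mathcal{M}}_i$ are the corresponding functors over $S$ for the semidualizing $S$-module $S\otimes_R C$. *)

(* Defs.v *)
From HB Require Import structures.
From mathcomp Require Import all_boot all_order all_algebra generic_quotient.
From mathcomp Require Import boolp.

Set Implicit Arguments.
Unset Strict Implicit.
Unset Printing Implicit Defensive.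

Import GRing.Theory.

Local Open Scope ring_scope.
Local Open Scope quotient_scope.

(* Rings are [comPzRingType]: the zero ring is allowed, both for the base    *)
(* ring and for the target of a flat ring homomorphism.                      *)

Section SubQuotient.
Context (R : pzRingType) (V : lmodType R) (U : submodClosed V).

Record submodule : Type := Submodule {
  submodule_val :> V;
  submodule_valP : submodule_val \in U }.

HB.instance Definition _ := [isSub for submodule_val].
HB.instance Definition _ := [Choice of submodule by <:].
HB.instance Definition _ := [SubChoice_isSubLmodule of submodule by <:].

Definition quotmod_rel (x y : V) : bool := x - y \in U.

Let submod_opp (x : V) : x \in U -> - x \in U.
Proof. by rewrite -scaleN1r; apply: rpredZ. Qed.

Fact quotmod_equiv : equiv_class_of quotmod_rel.
Proof.
split=> [x|x y|y x z]; rewrite /quotmod_rel ?subrr ?rpred0 //.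
  by apply/idP/idP => /submod_opp; rewrite opprB.
by move=> xy yz; rewrite -[x](subrK y) -addrA rpredD.
Qed.

Canonical quotmod_equiv_rel := EquivRelPack quotmod_equiv.
Canonical quotmod_encModRel := defaultEncModRel quotmod_rel.

Definition quotmod : Type := {eq_quot quotmod_rel}.
HB.instance Definition _ : EqQuotient V quotmod_rel quotmod :=
  EqQuotient.on quotmod.
HB.instance Definition _ := Choice.on quotmod.

Definition quotmod_pi : V -> quotmod := \pi_quotmod.
Definition quotmod_add (x y : quotmod) := quotmod_pi (repr x + repr y).
Definition quotmod_opp (x : quotmod) := quotmod_pi (- repr x).
Definition quotmod_scale (a : R) (x : quotmod) := quotmod_pi (a *: repr x).

Lemma quotmod_piP (x y : V) : (quotmod_pi x = quotmod_pi y) <-> (x - y \in U).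
Proof. by split=> [/eqmodP|h]; last apply/eqmodP. Qed.

Lemma quotmod_reprP (x : V) : repr (quotmod_pi x) - x \in U.
Proof. by apply/quotmod_piP; rewrite /quotmod_pi reprK. Qed.

Lemma quotmod_pi_surj (x : quotmod) : exists v, x = quotmod_pi v.
Proof. by exists (repr x); rewrite /quotmod_pi reprK. Qed.

Lemma quotmod_piD x y :
  quotmod_add (quotmod_pi x) (quotmod_pi y) = quotmod_pi (x + y).
Proof.
by apply/quotmod_piP; rewrite opprD addrACA rpredD ?quotmod_reprP.
Qed.

Lemma quotmod_piN x : quotmod_opp (quotmod_pi x) = quotmod_pi (- x).
Proof. by apply/quotmod_piP; rewrite -opprD submod_opp ?quotmod_reprP. Qed.

Lemma quotmod_piZ a x : quotmod_scale a (quotmod_pi x) = quotmod_pi (a *: x).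
Proof. by apply/quotmod_piP; rewrite -scalerBr rpredZ ?quotmod_reprP. Qed.

Fact quotmod_addA : associative quotmod_add.
Proof.
move=> x y z.
case: (quotmod_pi_surj x) (quotmod_pi_surj y) (quotmod_pi_surj z).
move=> u -> [v ->] [w ->].
by rewrite !quotmod_piD addrA.
Qed.

Fact quotmod_addC : commutative quotmod_add.
Proof. by move=> x y; rewrite /quotmod_add addrC. Qed.

Fact quotmod_add0 : left_id (quotmod_pi 0) quotmod_add.
Proof. by move=> x; have [u ->] := quotmod_pi_surj x; rewrite quotmod_piD add0r. Qed.

Fact quotmod_addN : left_inverse (quotmod_pi 0) quotmod_opp quotmod_add.
Proof.
by move=> x; have [u ->] := quotmod_pi_surj x; rewrite quotmod_piN quotmod_piD addNr.
Qed.

HB.instance Definition _ := GRing.isZmodule.Build quotmod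
  quotmod_addA quotmod_addC quotmod_add0 quotmod_addN.

Fact quotmod_scaleA a b x :
  quotmod_scale a (quotmod_scale b x) = quotmod_scale (a * b) x.
Proof. by have [u ->] := quotmod_pi_surj x; rewrite !quotmod_piZ scalerA. Qed.

Fact quotmod_scale1 : left_id 1 quotmod_scale.
Proof. by move=> x; have [u ->] := quotmod_pi_surj x; rewrite quotmod_piZ scale1r. Qed.

Fact quotmod_scaleDr : right_distributive quotmod_scale +%R.
Proof.
move=> a x y; case: (quotmod_pi_surj x) (quotmod_pi_surj y) => u -> [v ->].
by rewrite /GRing.add /= !(quotmod_piZ, quotmod_piD) scalerDr.
Qed.

Fact quotmod_scaleDl x : {morph quotmod_scale^~ x : a b / a + b}.
Proof.
move=> a b; have [u ->] := quotmod_pi_surj x.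
by rewrite [RHS]/GRing.add /= !(quotmod_piZ, quotmod_piD) scalerDl.
Qed.

HB.instance Definition _ := GRing.Zmodule_isLmodule.Build R quotmod
  quotmod_scaleA quotmod_scale1 quotmod_scaleDr quotmod_scaleDl.

Fact quotmod_pi_is_linear : linear quotmod_pi.
Proof.
by move=> a x y; rewrite -quotmod_piD -quotmod_piZ.
Qed.
HB.instance Definition _ :=
  GRing.isLinear.Build R V quotmod _ quotmod_pi quotmod_pi_is_linear.

End SubQuotient.

Section KernelImage.
Context (R : pzRingType) (U V : lmodType R) (f : {linear U -> V}).

Definition ker_pred : {pred U} := [pred x | f x == 0].
Definition im_pred : {pred V} := [pred y | `[< exists x, f x = y >]].

Fact ker_pred_submod : subsemimod_closed ker_pred.
Proof.
split; first split; rewrite ?inE ?linear0 //.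
  by move=> x y; rewrite !inE linearD => /eqP-> /eqP->; rewrite addr0.
by move=> a x; rewrite !inE linearZ => /eqP->; rewrite /= scaler0.
Qed.
HB.instance Definition _ := GRing.isSubmodClosed.Build R U ker_pred ker_pred_submod.

Fact im_pred_submod : subsemimod_closed im_pred.
Proof.
split; first split.
- by rewrite inE; apply/asboolP; exists 0; rewrite linear0.
- move=> _ _ /asboolP[x <-] /asboolP[y <-].
  by apply/asboolP; exists (x + y); rewrite linearD.
- by move=> a _ /asboolP[x <-]; apply/asboolP; exists (a *: x); rewrite linearZ.
Qed.
HB.instance Definition _ := GRing.isSubmodClosed.Build R V im_pred im_pred_submod.

End KernelImage.

(* ker g / (im f :&: ker g); the composite is not required to vanish, though  *)
(* it does wherever this is used.                                             *)
Section Homology.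
Context (R : pzRingType) (U V W : lmodType R).
Context (f : {linear U -> V}) (g : {linear V -> W}).

Definition cycles : lmodType R := submodule (ker_pred g).

Definition boundary_pred : {pred cycles} :=
  [pred z | (val z : V) \in im_pred f].

Fact boundary_pred_submod : subsemimod_closed boundary_pred.
Proof.
split; first split.
- by change (val (0 : cycles) \in im_pred f); rewrite raddf0 rpred0.
- move=> x y hx hy; change (val (x + y) \in im_pred f).
  by rewrite raddfD; apply: rpredD.
- move=> a x hx; change (val (a *: x) \in im_pred f).
  by rewrite linearZ; apply: rpredZ.
Qed.
HB.instance Definition _ :=
  GRing.isSubmodClosed.Build R cycles boundary_pred boundary_pred_submod.

Definition homology : lmodType R := quotmod boundary_pred.

Lemma homology_eq0P :
  (forall x : homology, x = 0) <->
  (forall v, g v = 0 -> exists u, f u = v).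
Proof.
split=> [H0 v gv0|ex x].
  have kv : v \in ker_pred g by rewrite inE gv0.
  have /quotmod_piP : quotmod_pi boundary_pred (Submodule kv : cycles) =
      quotmod_pi boundary_pred 0 by rewrite linear0; apply: H0.
  by rewrite subr0 => /asboolP.
have [z ->] := quotmod_pi_surj x; rewrite -(linear0 (quotmod_pi boundary_pred)).
apply/quotmod_piP; rewrite subr0; apply/asboolP/ex/eqP.
exact: (submodule_valP z).
Qed.

End Homology.

Definition isomorphic (R : pzRingType) (U V : lmodType R) : Prop :=
  exists f : {linear U -> V}, bijective f.

Definition is_zero_module (R : pzRingType) (V : lmodType R) : Prop :=
  forall x : V, x = 0.

Section HomModule.
Context (R : comPzRingType) (U V : lmodType R).

Definition Hom : Type := {linear U -> V}.
HB.instance Definition _ := gen_eqMixin Hom.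
HB.instance Definition _ := gen_choiceMixin Hom.

Lemma HomP (f g : Hom) : (forall x, f x = g x) -> f = g.
Proof.
case: f g => [f cf] [g cg] /= /funext efg; subst g.
case: cf cg => [[f1] [f2]] [[g1] [g2]].
by rewrite (Prop_irrelevance f1 g1) (Prop_irrelevance f2 g2).
Qed.

Definition hom_zero : Hom := (\0 : U -> V).
Definition hom_add (f g : Hom) : Hom := (f \+ g : U -> V).
Definition hom_opp (f : Hom) : Hom := (\- f : U -> V).
Definition hom_scale (a : R) (f : Hom) : Hom := (a \*: f : U -> V).

Fact hom_addA : associative hom_add.
Proof. by move=> f g h; apply: HomP => x /=; rewrite addrA. Qed.
Fact hom_addC : commutative hom_add.
Proof. by move=> f g; apply: HomP => x /=; rewrite addrC. Qed.
Fact hom_add0 : left_id hom_zero hom_add.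
Proof. by move=> f; apply: HomP => x /=; rewrite add0r. Qed.
Fact hom_addN : left_inverse hom_zero hom_opp hom_add.
Proof. by move=> f; apply: HomP => x /=; rewrite addNr. Qed.
HB.instance Definition _ :=
  GRing.isZmodule.Build Hom hom_addA hom_addC hom_add0 hom_addN.

Fact hom_scaleA a b f : hom_scale a (hom_scale b f) = hom_scale (a * b) f.
Proof. by apply: HomP => x /=; rewrite scalerA. Qed.
Fact hom_scale1 : left_id 1 hom_scale.
Proof. by move=> f; apply: HomP => x /=; rewrite scale1r. Qed.
Fact hom_scaleDr : right_distributive hom_scale +%R.
Proof. by move=> a f g; apply: HomP => x /=; rewrite scalerDr. Qed.
Fact hom_scaleDl f : {morph hom_scale^~ f : a b / a + b}.
Proof. by move=> a b; apply: HomP => x /=; rewrite scalerDl. Qed.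
HB.instance Definition _ := GRing.Zmodule_isLmodule.Build R Hom
  hom_scaleA hom_scale1 hom_scaleDr hom_scaleDl.

End HomModule.

Section HomFunctor.
Context (R : comPzRingType) (U V W : lmodType R).

Definition hom_postcomp (g : {linear V -> W}) (f : Hom U V) : Hom U W :=
  (g \o (f : {linear U -> V}) : U -> W).

Fact hom_postcomp_is_linear g : linear (hom_postcomp g).
Proof. by move=> a f h; apply: HomP => x /=; rewrite linearD linearZ. Qed.
HB.instance Definition _ g := GRing.isLinear.Build R (Hom U V) (Hom U W) _
  (hom_postcomp g) (hom_postcomp_is_linear g).

Definition hom_precomp (g : {linear U -> V}) (f : Hom V W) : Hom U W :=
  ((f : {linear V -> W}) \o g : U -> W).

Fact hom_precomp_is_linear g : linear (hom_precomp g).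
Proof. by move=> a f h; apply: HomP. Qed.
HB.instance Definition _ g := GRing.isLinear.Build R (Hom V W) (Hom U W) _
  (hom_precomp g) (hom_precomp_is_linear g).

End HomFunctor.

Arguments hom_postcomp {R} U {V W} g.
Arguments hom_precomp {R U V} W g.

Definition homothety (R : comPzRingType) (C : lmodType R) (r : R) : Hom C C :=
  ( *:%R r : C -> C).

(* Elements of M (x) N are formal sums of pairs (m, n), i.e., sequences,      *)
(* modulo the least additive congruence making (m, n) |-> [:: (m, n)]         *)
(* bilinear.  No coefficients are needed, since r (m (x) n) = (r m) (x) n.    *)
Section Tensor.
Context (R : comPzRingType) (M N : lmodType R).

Inductive tensor_eqv : seq (M * N) -> seq (M * N) -> Prop :=
| TensorRefl s : tensor_eqv s s
| TensorSym s t : tensor_eqv s t -> tensor_eqv t s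
| TensorTrans s t u : tensor_eqv s t -> tensor_eqv t u -> tensor_eqv s u
| TensorCat s s' t t' :
    tensor_eqv s s' -> tensor_eqv t t' -> tensor_eqv (s ++ t) (s' ++ t')
| TensorCatC s t : tensor_eqv (s ++ t) (t ++ s)
| TensorZeroL n : tensor_eqv [:: (0, n)] [::]
| TensorZeroR m : tensor_eqv [:: (m, 0)] [::]
| TensorAddL m m' n : tensor_eqv [:: (m + m', n)] [:: (m, n); (m', n)]
| TensorAddR m n n' : tensor_eqv [:: (m, n + n')] [:: (m, n); (m, n')]
| TensorScale r m n : tensor_eqv [:: (r *: m, n)] [:: (m, r *: n)].

Definition tensor_rel (s t : seq (M * N)) : bool := `[< tensor_eqv s t >].

Fact tensor_rel_equiv : equiv_class_of tensor_rel.
Proof.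
split=> [s|s t|t s u]; first exact/asboolP/TensorRefl.
  by apply/asboolP/asboolP => /TensorSym.
by move=> /asboolP st /asboolP tu; apply/asboolP/(TensorTrans st).
Qed.

Canonical tensor_equiv_rel := EquivRelPack tensor_rel_equiv.
Canonical tensor_encModRel := defaultEncModRel tensor_rel.

Definition tensor : Type := {eq_quot tensor_rel}.
HB.instance Definition _ : EqQuotient (seq (M * N)) tensor_rel tensor :=
  EqQuotient.on tensor.
HB.instance Definition _ := Choice.on tensor.

Definition tensor_pi : seq (M * N) -> tensor := \pi_tensor.

Lemma tensor_piP s t : tensor_pi s = tensor_pi t <-> tensor_eqv s t.
Proof. by split=> [/eqmodP/asboolP|h] //; apply/eqmodP/asboolP. Qed.

Lemma tensor_reprP s : tensor_eqv (repr (tensor_pi s)) s.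
Proof. by apply/tensor_piP; rewrite /tensor_pi reprK. Qed.

Lemma tensor_pi_surj (x : tensor) : exists s, x = tensor_pi s.
Proof. by exists (repr x); rewrite /tensor_pi reprK. Qed.

Definition tensor_scale_seq (r : R) (s : seq (M * N)) : seq (M * N) :=
  [seq (r *: p.1, p.2) | p <- s].

Definition tensor_add (x y : tensor) : tensor := tensor_pi (repr x ++ repr y).
Definition tensor_scale (r : R) (x : tensor) : tensor :=
  tensor_pi (tensor_scale_seq r (repr x)).
Definition tensor_opp (x : tensor) : tensor := tensor_scale (- 1) x.

Lemma tensor_scale_eqv r s t : tensor_eqv s t ->
  tensor_eqv (tensor_scale_seq r s) (tensor_scale_seq r t).
Proof.
elim=> {s t}; rewrite /tensor_scale_seq.
- by move=> s; apply: TensorRefl.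
- by move=> s t _; apply: TensorSym.
- by move=> s t u _ st _; apply: TensorTrans.
- by move=> s s' t t' _ ss _ tt; rewrite !map_cat; apply: TensorCat.
- by move=> s t; rewrite !map_cat; apply: TensorCatC.
- by move=> n /=; rewrite scaler0; apply: TensorZeroL.
- by move=> m /=; apply: TensorZeroR.
- by move=> m m' n /=; rewrite scalerDr; apply: TensorAddL.
- by move=> m n n' /=; apply: TensorAddR.
- by move=> a m n /=; rewrite scalerA mulrC -scalerA; apply: TensorScale.
Qed.

Lemma tensor_pi_cat s t :
  tensor_add (tensor_pi s) (tensor_pi t) = tensor_pi (s ++ t).
Proof. by apply/tensor_piP/TensorCat; apply: tensor_reprP. Qed.

Lemma tensor_pi_scale r s :
  tensor_scale r (tensor_pi s) = tensor_pi (tensor_scale_seq r s).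
Proof. by apply/tensor_piP/tensor_scale_eqv/tensor_reprP. Qed.

Fact tensor_addA : associative tensor_add.
Proof.
move=> x y z.
case: (tensor_pi_surj x) (tensor_pi_surj y) (tensor_pi_surj z).
by move=> s -> [t ->] [u ->]; rewrite !tensor_pi_cat catA.
Qed.

Fact tensor_addC : commutative tensor_add.
Proof. by move=> x y; apply/tensor_piP/TensorCatC. Qed.

Fact tensor_add0 : left_id (tensor_pi [::]) tensor_add.
Proof. by move=> x; case: (tensor_pi_surj x) => s ->; rewrite tensor_pi_cat. Qed.

Let tensor_pi_cons p s :
  tensor_pi (p :: s) = tensor_add (tensor_pi [:: p]) (tensor_pi s).
Proof. by rewrite tensor_pi_cat. Qed.

Let tensor_addACA : interchange tensor_add tensor_add.
Proof.
move=> x y z t.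
by rewrite -!tensor_addA; congr tensor_add; rewrite !tensor_addA (tensor_addC y).
Qed.

Fact tensor_scaleDl x r r' :
  tensor_scale (r + r') x = tensor_add (tensor_scale r x) (tensor_scale r' x).
Proof.
case: (tensor_pi_surj x) => s ->; rewrite !tensor_pi_scale.
elim: s => [|[m n] s IHs]; first by rewrite tensor_pi_cat.
rewrite /= tensor_pi_cons IHs [in RHS]tensor_pi_cons.
rewrite [X in _ = tensor_add _ X]tensor_pi_cons tensor_addACA.
by congr tensor_add; rewrite tensor_pi_cat scalerDl; apply/tensor_piP/TensorAddL.
Qed.

Fact tensor_scale1 x : tensor_scale 1 x = x.
Proof.
case: (tensor_pi_surj x) => s ->; rewrite tensor_pi_scale.
congr tensor_pi; rewrite /tensor_scale_seq -[RHS]map_id.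
by apply: eq_map => -[m n] /=; rewrite scale1r.
Qed.

Fact tensor_scale0 x : tensor_scale 0 x = tensor_pi [::].
Proof.
case: (tensor_pi_surj x) => s ->; rewrite tensor_pi_scale.
elim: s => //= p s IHs; rewrite tensor_pi_cons IHs scale0r.
rewrite tensor_addC tensor_add0.
exact/tensor_piP/TensorZeroL.
Qed.

Fact tensor_addN : left_inverse (tensor_pi [::]) tensor_opp tensor_add.
Proof.
by move=> x; rewrite -[X in tensor_add _ X]tensor_scale1 -tensor_scaleDl addNr
                     tensor_scale0.
Qed.

HB.instance Definition _ := GRing.isZmodule.Build tensor
  tensor_addA tensor_addC tensor_add0 tensor_addN.

Fact tensor_scaleA r r' x :
  tensor_scale r (tensor_scale r' x) = tensor_scale (r * r') x.
Proof.
case: (tensor_pi_surj x) => s ->; rewrite !tensor_pi_scale.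
congr tensor_pi; rewrite /tensor_scale_seq -map_comp.
by apply: eq_map => -[m n] /=; rewrite scalerA.
Qed.

Fact tensor_scaleDr : right_distributive tensor_scale +%R.
Proof.
move=> r x y; case: (tensor_pi_surj x) (tensor_pi_surj y) => s -> [t ->].
rewrite /GRing.add /= !(tensor_pi_cat, tensor_pi_scale).
by rewrite /tensor_scale_seq map_cat.
Qed.

HB.instance Definition _ := GRing.Zmodule_isLmodule.Build R tensor
  tensor_scaleA tensor_scale1 tensor_scaleDr tensor_scaleDl.

Definition tpure (m : M) (n : N) : tensor := tensor_pi [:: (m, n)].

Lemma tpureDl m m' n : tpure (m + m') n = tpure m n + tpure m' n.
Proof.
by rewrite [RHS]/GRing.add /= tensor_pi_cat; apply/tensor_piP/TensorAddL.
Qed.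

Lemma tpureDr m n n' : tpure m (n + n') = tpure m n + tpure m n'.
Proof.
by rewrite [RHS]/GRing.add /= tensor_pi_cat; apply/tensor_piP/TensorAddR.
Qed.

Lemma tpureZl r m n : tpure (r *: m) n = r *: tpure m n.
Proof. by rewrite [RHS]/GRing.scale /= tensor_pi_scale. Qed.

Lemma tpureZr r m n : tpure m (r *: n) = r *: tpure m n.
Proof. by rewrite -tpureZl; apply/tensor_piP/TensorSym/TensorScale. Qed.

Lemma tensor_pi_sum s : tensor_pi s = \sum_(p <- s) tpure p.1 p.2.
Proof.
elim: s => [|[m n] s IHs]; first by rewrite big_nil.
by rewrite big_cons /= -IHs /GRing.add /= tensor_pi_cat.
Qed.

Lemma tensor_ind (P : tensor -> Prop) :
  P 0 -> (forall m n x, P x -> P (tpure m n + x)) -> forall x, P x.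
Proof.
move=> P0 PD x; case: (tensor_pi_surj x) => s ->.
rewrite tensor_pi_sum; elim: s => [|p s IHs]; first by rewrite big_nil.
by rewrite big_cons; apply: PD.
Qed.

Section Lift.
Context (W : lmodType R) (b : M -> N -> W).
Hypothesis b_linearl : forall n, linear (b^~ n).
Hypothesis b_linearr : forall m, linear (b m).

Let ev (s : seq (M * N)) : W := \sum_(p <- s) b p.1 p.2.

Let ev_eqv s t : tensor_eqv s t -> ev s = ev t.
Proof.
have b0l n : b 0 n = 0.
  by have := b_linearl n (- 1) 0 0; rewrite scaler0 addr0 scaleN1r addNr.
have b0r m : b m 0 = 0.
  by have := b_linearr m (- 1) 0 0; rewrite scaler0 addr0 scaleN1r addNr.
rewrite /ev; elim=> {s t}.
- by [].
- by [].
- by move=> s t u _ -> _ ->.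
- by move=> s s' t t' _ es _ et; rewrite !big_cat es et.
- by move=> s t; rewrite !big_cat /= addrC.
- by move=> n; rewrite big_seq1 big_nil b0l.
- by move=> m; rewrite big_seq1 big_nil b0r.
- move=> m m' n; rewrite !big_cons !big_nil !addr0 /=.
  by have := b_linearl n 1 m m'; rewrite !scale1r.
- move=> m n n'; rewrite !big_cons !big_nil !addr0 /=.
  by have := b_linearr m 1 n n'; rewrite !scale1r.
- move=> r m n; rewrite !big_cons !big_nil !addr0 /=.
  have := b_linearl n r m 0; rewrite !addr0 b0l addr0 => ->.
  by have := b_linearr m r n 0; rewrite !addr0 b0r addr0 => ->.
Qed.

Lemma tensor_lift :
  exists f : {linear tensor -> W}, forall m n, f (tpure m n) = b m n.
Proof.
pose f (x : tensor) := ev (repr x).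
have f_pi s : f (tensor_pi s) = ev s by apply/ev_eqv/tensor_reprP.
have f_lin : linear f.
  move=> r x y; case: (tensor_pi_surj x) (tensor_pi_surj y) => s -> [t ->].
  rewrite [X in f (X + _)]/GRing.scale /GRing.add /=.
  rewrite tensor_pi_scale tensor_pi_cat !f_pi /ev big_cat.
  congr (_ + _); rewrite big_map scaler_sumr; apply: eq_bigr => -[m n] _ /=.
  have b0l : b 0 n = 0.
    by have := b_linearl n (- 1) 0 0; rewrite scaler0 addr0 scaleN1r addNr.
  by have := b_linearl n r m 0; rewrite !addr0 b0l addr0.
pose fL : {linear tensor -> W} :=
  HB.pack f (GRing.isLinear.Build R tensor W _ f f_lin).
by exists fL => m n; rewrite /= /tpure f_pi /ev big_seq1.
Qed.
End Lift.

Lemma tensor_linear_eq (W : lmodType R) (f g : {linear tensor -> W}) :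
  (forall m n, f (tpure m n) = g (tpure m n)) -> forall x, f x = g x.
Proof.
move=> efg; elim/tensor_ind => [|m n x IHx]; first by rewrite !linear0.
by rewrite !linearD efg IHx.
Qed.

End Tensor.

Arguments tpure {R M N} m n.

Section TensorMap.
Context (R : comPzRingType) (M M' N N' : lmodType R).
Context (f : {linear M -> M'}) (g : {linear N -> N'}).

Fact tensor_map_eqv s t : tensor_eqv s t ->
  tensor_eqv [seq (f p.1, g p.2) | p <- s] [seq (f p.1, g p.2) | p <- t].
Proof.
elim=> {s t}.
- by move=> s; apply: TensorRefl.
- by move=> s t _; apply: TensorSym.
- by move=> s t u _ st _; apply: TensorTrans.
- by move=> s s' t t' _ ss _ tt; rewrite !map_cat; apply: TensorCat.
- by move=> s t; rewrite !map_cat; apply: TensorCatC.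
- by move=> n /=; rewrite linear0; apply: TensorZeroL.
- by move=> m /=; rewrite (linear0 g); apply: TensorZeroR.
- by move=> m m' n /=; rewrite linearD; apply: TensorAddL.
- by move=> m n n' /=; rewrite (linearD g); apply: TensorAddR.
- by move=> a m n /=; rewrite !linearZZ; apply: TensorScale.
Qed.

Definition tensor_map (x : tensor M N) : tensor M' N' :=
  tensor_pi [seq (f p.1, g p.2) | p <- repr x].

Lemma tensor_map_pi s :
  tensor_map (tensor_pi s) = tensor_pi [seq (f p.1, g p.2) | p <- s].
Proof. by apply/tensor_piP/tensor_map_eqv/tensor_reprP. Qed.

Lemma tensor_map_pure m n : tensor_map (tpure m n) = tpure (f m) (g n).
Proof. by rewrite /tpure tensor_map_pi. Qed.

Fact tensor_map_is_linear : linear tensor_map.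
Proof.
move=> r x y; case: (tensor_pi_surj x) (tensor_pi_surj y) => s -> [t ->].
rewrite /GRing.scale /GRing.add /= !(tensor_pi_scale, tensor_map_pi, tensor_pi_cat).
congr tensor_pi; rewrite map_cat /tensor_scale_seq -!map_comp; congr (_ ++ _).
by apply: eq_map => p /=; rewrite linearZ.
Qed.
HB.instance Definition _ := GRing.isLinear.Build R (tensor M N) (tensor M' N') _
  tensor_map tensor_map_is_linear.

End TensorMap.

Definition restrict (R S : comPzRingType) (phi : {rmorphism R -> S})
  (V : lmodType S) : Type := V.

Section Restrict.
Context (R S : comPzRingType) (phi : {rmorphism R -> S}) (V : lmodType S).
Local Notation W := (restrict phi V).

HB.instance Definition _ := GRing.Zmodule.copy W V.

Definition restrict_scale (r : R) (v : W) : W := phi r *: (v : V).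

Fact restrict_scaleA r r' v :
  restrict_scale r (restrict_scale r' v) = restrict_scale (r * r') v.
Proof. by rewrite /restrict_scale scalerA rmorphM. Qed.
Fact restrict_scale1 : left_id 1 restrict_scale.
Proof. by move=> v; rewrite /restrict_scale rmorph1 scale1r. Qed.
Fact restrict_scaleDr : right_distributive restrict_scale +%R.
Proof. by move=> r v w; rewrite /restrict_scale (@scalerDr _ V). Qed.
Fact restrict_scaleDl v : {morph restrict_scale^~ v : r r' / r + r'}.
Proof. by move=> r r'; rewrite /restrict_scale rmorphD (@scalerDl _ V). Qed.
HB.instance Definition _ := GRing.Zmodule_isLmodule.Build R W
  restrict_scaleA restrict_scale1 restrict_scaleDr restrict_scaleDl.

Definition restrict_mul (s : S) (v : W) : W := s *: (v : V).

Fact restrict_mul_is_linear s : linear (restrict_mul s).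
Proof.
move=> r v w; rewrite /restrict_mul (@scalerDr _ V); congr (_ + _).
change (s *: (phi r *: (v : V)) = phi r *: (s *: (v : V))).
by rewrite !scalerA mulrC.
Qed.
HB.instance Definition _ s := GRing.isLinear.Build R W W _
  (restrict_mul s) (restrict_mul_is_linear s).

End Restrict.

Definition extend (R S : comPzRingType) (phi : {rmorphism R -> S})
  (M : lmodType R) : Type := tensor (restrict phi S^o) M.

Section Extend.
Context (R S : comPzRingType) (phi : {rmorphism R -> S}) (M : lmodType R).
Local Notation T := (tensor (restrict phi S^o) M).
Local Notation E := (extend phi M).

HB.instance Definition _ := GRing.Zmodule.copy E T.

(* The S-action is s (s' (x) m) = (s s') (x) m.                               *)
Definition extend_scale (s : S) (x : T) : T :=
  tensor_map (restrict_mul s : {linear restrict phi S^o -> restrict phi S^o})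
    (idfun : {linear M -> M}) x.

Let extend_scale0 s : extend_scale s 0 = 0.
Proof. by rewrite /extend_scale linear0. Qed.

Let extend_scale_pure (s s' : S) m x :
  extend_scale s (tpure (s' : restrict phi S^o) m + x) =
    tpure (s * s' : restrict phi S^o) m + extend_scale s x.
Proof. by rewrite /extend_scale linearD /= tensor_map_pure. Qed.

Fact extend_scaleA s s' x :
  extend_scale s (extend_scale s' x) = extend_scale (s * s') x.
Proof.
elim/tensor_ind: x => [|m n x IHx]; first by rewrite !extend_scale0.
by rewrite !extend_scale_pure IHx mulrA.
Qed.
Fact extend_scale1 : left_id 1 extend_scale.
Proof.
elim/tensor_ind => [|m n x IHx]; first by rewrite extend_scale0.
by rewrite extend_scale_pure IHx mul1r.
Qed.
Fact extend_scaleDr : right_distributive extend_scale +%R.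
Proof. by move=> s x y; rewrite /extend_scale linearD. Qed.
Fact extend_scaleDl x : {morph extend_scale^~ x : s s' / s + s'}.
Proof.
move=> s s'; elim/tensor_ind: x => [|m n x IHx].
  by rewrite !extend_scale0 addr0.
by rewrite !extend_scale_pure IHx addrACA -tpureDl mulrDl.
Qed.
HB.instance Definition _ := GRing.Zmodule_isLmodule.Build S E
  extend_scaleA extend_scale1 extend_scaleDr extend_scaleDl.

End Extend.

Definition finitely_generated (R : pzRingType) (M : lmodType R) : Prop :=
  exists s : seq M, forall x : M,
    exists c : nat -> R, x = \sum_(i < size s) c i *: s`_i.

Definition noetherian (R : comPzRingType) : Prop :=
  forall I : submodClosed R^o, finitely_generated (submodule I).

Definition projective (R : comPzRingType) (P : lmodType R) : Prop :=
  forall (U V : lmodType R) (g : {linear U -> V}) (f : {linear P -> V}),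
    (forall v, exists u, g u = v) ->
    exists h : {linear P -> U}, forall x, g (h x) = f x.

Definition flat (R : comPzRingType) (F : lmodType R) : Prop :=
  forall (U V : lmodType R) (g : {linear U -> V}),
    injective g -> injective (tensor_map (idfun : {linear F -> F}) g).

Definition flat_morphism (R S : comPzRingType) (phi : {rmorphism R -> S}) :=
  flat (restrict phi S^o).

Record complex (R : comPzRingType) : Type := Complex {
  complex_ob :> nat -> lmodType R;
  complex_d : forall n, {linear complex_ob n.+1 -> complex_ob n};
  complex_dd : forall n x, complex_d n (complex_d n.+1 x) = 0 }.

Arguments complex_d {R} c n.

Section Complexes.
Context (R : comPzRingType).
Implicit Types (X : complex R) (M N Y : lmodType R).

(* The differential leaving degree n; it is 0 in degree 0, where the          *)
(* truncated predecessor 0.-1 = 0 stands for degree -1.                       *)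
Definition complex_out X n : {linear X n -> X n.-1} :=
  match n with
  | 0 => (\0 : X 0 -> X 0)
  | k.+1 => complex_d X k
  end.

Definition complex_homology X n : lmodType R :=
  homology (complex_d X n) (complex_out X n).

Definition exact_complex X : Prop :=
  forall n, is_zero_module (complex_homology X n).

Fact hom_complex_dd Y X n x :
  hom_postcomp Y (complex_d X n) (hom_postcomp Y (complex_d X n.+1) x) = 0.
Proof. by apply: HomP => y; apply: complex_dd. Qed.

Definition hom_complex Y X : complex R :=
  @Complex R (fun n => Hom Y (X n)) (fun n => hom_postcomp Y (complex_d X n))
    (@hom_complex_dd Y X).

Fact tensor_complex_dd X N n x :
  tensor_map (complex_d X n) (idfun : {linear N -> N})
    (tensor_map (complex_d X n.+1) (idfun : {linear N -> N}) x) = 0.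
Proof.
elim/tensor_ind: x => [|m y x IHx]; first by rewrite !linear0.
rewrite !linearD /= IHx !tensor_map_pure complex_dd addr0.
by rewrite -(scale0r (0 : X n)) tpureZl scale0r.
Qed.

Definition tensor_complex X N : complex R :=
  @Complex R (fun n => tensor (X n) N)
    (fun n => tensor_map (complex_d X n) (idfun : {linear N -> N}))
    (@tensor_complex_dd X N).

(* The cochain complex is Hom(X 0, N) -> Hom(X 1, N) -> ... , with 0 before    *)
(* degree 0.                                                                  *)
Definition hom_cohomology X N n : lmodType R :=
  match n with
  | 0 => homology (\0 : Hom (X 0) N -> Hom (X 0) N)
           (hom_precomp N (complex_d X 0))
  | k.+1 => homology (hom_precomp N (complex_d X k))
              (hom_precomp N (complex_d X k.+1))
  end.

End Complexes.

Record augmented (R : comPzRingType) (M : lmodType R) : Type := Augmented {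
  aug_complex :> complex R;
  aug_map : {linear aug_complex 0 -> M};
  aug_mapd : forall x, aug_map (complex_d aug_complex 0 x) = 0 }.

Section Augment.
Context (R : comPzRingType) (M : lmodType R) (X : augmented M).

Definition augment_ob (n : nat) : lmodType R := if n is k.+1 then X k else M.

Definition augment_d n : {linear augment_ob n.+1 -> augment_ob n} :=
  match n with
  | 0 => aug_map X
  | k.+1 => complex_d X k
  end.

Fact augment_dd n x : augment_d n (augment_d n.+1 x) = 0.
Proof. by case: n x => [|n] x; [apply: aug_mapd | apply: complex_dd]. Qed.

(* X^+ : ... -> X_1 -> X_0 -> M -> 0, reindexed so that M is in degree 0.     *)
Definition augment : complex R := Complex augment_dd.

End Augment.

Record projective_resolution (R : comPzRingType) (M : lmodType R) :=
  ProjectiveResolution {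
    pres_aug :> augmented M;
    pres_projective : forall n, projective (pres_aug n);
    pres_exact : exact_complex (augment pres_aug) }.

(* As for [relTor] below, the resolution is a parameter.                      *)
Definition Ext (R : comPzRingType) (M : lmodType R)
    (P : projective_resolution M) (N : lmodType R) (i : nat) : lmodType R :=
  hom_cohomology P N i.

Definition semidualizing (R : comPzRingType) (C : lmodType R) : Prop :=
  [/\ finitely_generated C,
      bijective (@homothety R C) &
      forall (P : projective_resolution C) (i : nat),
        (1 <= i)%N -> is_zero_module (Ext P C i)].

Definition PC (R : comPzRingType) (C X : lmodType R) : Prop :=
  exists P : lmodType R, projective P /\ isomorphic X (tensor P C).

Definition FC (R : comPzRingType) (C X : lmodType R) : Prop :=
  exists F : lmodType R, flat F /\ isomorphic X (tensor F C).

Record proper_resolution (R : comPzRingType) (K : lmodType R -> Prop)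
    (M : lmodType R) := ProperResolution {
  prop_aug :> augmented M;
  prop_mem : forall n, K (prop_aug n);
  prop_proper : forall Y, K Y -> exact_complex (hom_complex Y (augment prop_aug)) }.

(* Tor^{K M}_i(M, N) is determined only up to isomorphism by (M, N, i), so    *)
(* the proper resolution it is computed from is kept as a parameter.          *)
Definition relTor (R : comPzRingType) (K : lmodType R -> Prop)
    (M : lmodType R) (Q : proper_resolution K M) (N : lmodType R) (i : nat) :
    lmodType R :=
  complex_homology (tensor_complex Q N) i.

(* Main.v *)
From HB Require Import structures.
From mathcomp Require Import all_boot all_order all_algebra.
From mathcomp Require Import boolp functions.
Require Import Defs.

(** Write [E = S (x)_R -], and say that an augmented complex [X] over [M] is a
    [C]-resolution when its terms have the form [F (x) C] with [F] flat and
    [Hom(C, X^+)] is exact.  Projective modules are flat and [C = R (x) C], so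
    proper [P_C]-resolutions and proper [F_C]-resolutions of [M] are both
    [C]-resolutions, and one argument treats both isomorphisms.  It does not try
    to show that [E] takes proper resolutions to proper ones: for [F_C] this can
    fail, because maps out of flat [S]-modules need not lift along the extension of
    a surjection along which maps out of flat [R]-modules lift.

    Two facts suffice.

    (1) [H_i(X (x) N)] is the same for all [C]-resolutions [X] of [M]
    ([C_resolution_independence]).  Since [C] is finitely presented and
    [R = Hom(C, C)], flat [F] satisfy [F = Hom(C, F (x) C)] ([unit_map_bij]), so
    that [Hom(C, X)] is a flat resolution of [Hom(C, M)] and
    [X (x) N = Hom(C, X) (x) (C (x) N)] ([eval_tensor_bij]).  The homology is
    therefore [Tor_i(Hom(C, M), C (x) N)], computed from a flat resolution.  That
    flat resolutions give a well-defined Tor is shown by shifting dimensions in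
    the other argument ([flat_resolution_independence]), which never needs a
    comparison map between two flat resolutions.

    (2) If [X] is a [C]-resolution of [M] then [E X] is an [E C]-resolution of
    [E M] ([extend_C_resolution]), and
    [H_i(E X (x)_S E N) = E (H_i(X (x) N))] ([extend_tensor_homology]).  The first
    claim rests on [Hom_S(E C, E V) = E (Hom_R(C, V))], valid because [C] is
    finitely presented and [S] is flat ([hom_tensor_bij]); the same identification
    gives [S = Hom_S(E C, E C)] ([extend_homothety]), so that (1) applies over [S].
    The second is exactness of [E].

    Homology modules are compared through linear relations between cycles
    ([homology_iso_rel]): this treats chain isomorphisms and connecting
    homomorphisms alike, without constructing maps on subquotients. *)

Set Implicit Arguments.
Unset Strict Implicit.
Unset Printing Implicit Defensive.

Import GRing.Theory.
Local Open Scope ring_scope.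

Local Notation idl M := (idfun : {linear M -> M}).

(** * Linear maps and isomorphisms *)

Definition linmap (R : pzRingType) (U V : lmodType R) (f : U -> V)
    (f_lin : linear f) : {linear U -> V} :=
  HB.pack f (GRing.isLinear.Build R U V _ f f_lin).

Lemma inj_surj_bij (T T' : Type) (f : T -> T') :
  injective f -> (forall y, exists x, f x = y) -> bijective f.
Proof.
move=> f_inj f_surj; pose g y := sval (cid (f_surj y)).
have fg : cancel g f by move=> y; exact: (svalP (cid (f_surj y))).
by exists g => // x; apply: f_inj; rewrite fg.
Qed.

Lemma bij_surj (T T' : Type) (f : T -> T') :
  bijective f -> forall y, exists x, f x = y.
Proof. by case=> g _ fg y; exists (g y). Qed.

Section Isomorphic.
Variable R : pzRingType.
Implicit Types U V W : lmodType R.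

Lemma bij_linear_inv U V (f : {linear U -> V}) : bijective f ->
  exists g : {linear V -> U}, cancel f g /\ cancel g f.
Proof.
case=> g fg gf.
have g_lin : linear g.
  by move=> a x y; apply: (can_inj fg); rewrite linearP !gf.
by exists (linmap g_lin).
Qed.

Lemma linear_inj U V (f : {linear U -> V}) :
  (forall x, f x = 0 -> x = 0) -> injective f.
Proof.
move=> f0 x y fxy; apply/eqP; rewrite -subr_eq0; apply/eqP/f0.
by rewrite linearB fxy subrr.
Qed.

Lemma isomorphic_sym U V : isomorphic U V -> isomorphic V U.
Proof.
case=> f /bij_linear_inv[g [fg gf]]; exists g.
by exists f.
Qed.

Lemma isomorphic_trans U V W :
  isomorphic U V -> isomorphic V W -> isomorphic U W.
Proof. by move=> [f bf] [g bg]; exists (g \o f : {linear U -> W}); exact: bij_comp. Qed.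

End Isomorphic.

(** * Isomorphisms between homology modules *)

Section HomologyClass.
Variables (R : pzRingType) (U V W : lmodType R).
Variables (f : {linear U -> V}) (g : {linear V -> W}).

Let ker_mem v : g v = 0 -> v \in ker_pred g.
Proof. by move=> gv; rewrite inE gv. Qed.

Definition hclass v (gv : g v = 0) : homology f g :=
  quotmod_pi _ (Submodule (ker_mem gv) : cycles g).

Lemma hclassP v v' (gv : g v = 0) (gv' : g v' = 0) :
  hclass gv = hclass gv' <-> exists u, f u = v - v'.
Proof.
apply: (iff_trans (quotmod_piP _ _ _)).
by split=> [/asboolP|?]; last apply/asboolP.
Qed.

Lemma hclass_surj x : exists v, exists gv : g v = 0, x = hclass gv.
Proof.
have [[v gv] ->] := quotmod_pi_surj x.
have gv0 : g v = 0 by move: (gv); rewrite inE => /eqP.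
exists v, gv0; rewrite /hclass; congr (quotmod_pi _ _).
exact: val_inj.
Qed.

Lemma hclass_lin a v v' (gv : g v = 0) (gv' : g v' = 0)
    (gvv' : g (a *: v + v') = 0) :
  hclass gvv' = a *: hclass gv + hclass gv'.
Proof.
rewrite /hclass -linearP; congr (quotmod_pi _ _).
exact: val_inj.
Qed.

Lemma hclass_eq0 v (gv : g v = 0) : hclass gv = 0 <-> exists u, f u = v.
Proof.
have g0 : g 0 = 0 by rewrite linear0.
have -> : 0 = hclass g0.
  rewrite -(linear0 (quotmod_pi (@boundary_pred _ _ _ _ f g))).
  by congr quotmod_pi; exact: val_inj.
by rewrite hclassP subr0.
Qed.

End HomologyClass.

(** A linear relation between cycles and [X] that is total on both sides, and
    under which the boundaries are exactly the partners of [0], is the graph of an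
    isomorphism modulo boundaries. *)
Lemma homology_rel_iso (R : pzRingType) (U V W X : lmodType R)
    (f : {linear U -> V}) (g : {linear V -> W}) (P : V -> X -> Prop) :
    (forall a v v' x x', P v x -> P v' x' -> P (a *: v + v') (a *: x + x')) ->
    (forall v, g v = 0 -> exists x, P v x) ->
    (forall x, exists v, g v = 0 /\ P v x) ->
    (forall v x, g v = 0 -> P v x -> (x = 0 <-> exists u, f u = v)) ->
  isomorphic (homology f g) X.
Proof.
move=> Plin Ptot Psurj P0; apply: isomorphic_sym.
pose w x := sval (cid (Psurj x)).
have gw x : g (w x) = 0 by have [] := svalP (cid (Psurj x)).
have Pw x : P (w x) x by have [] := svalP (cid (Psurj x)).
have PB v v' x x' : P v x -> P v' x' -> P (v - v') (x - x').
  move=> h h'; have := Plin (- 1) v' v x' x h' h.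
  by rewrite !scaleN1r addrC [- x' + _]addrC.
have gB v v' : g v = 0 -> g v' = 0 -> g (v - v') = 0.
  by move=> h h'; rewrite linearB h h' subrr.
pose h x := hclass f (gw x).
have h_lin : linear h.
  move=> a x y.
  have gxy : g (a *: w x + w y) = 0 by rewrite linearP !gw scaler0 addr0.
  rewrite /h -(hclass_lin f (gw x) (gw y) gxy); apply/hclassP.
  apply: (P0 _ _ (gB _ _ _ _) (PB _ _ _ _ (Pw _) (Plin _ _ _ _ _ (Pw x) (Pw y)))).1; [exact: gw|exact: gxy|exact: subrr].
exists (linmap h_lin); apply: inj_surj_bij => [x y /hclassP|z].
  move=> /(P0 _ _ (gB _ _ (gw x) (gw y)) (PB _ _ _ _ (Pw x) (Pw y))).2 /eqP.
  by rewrite subr_eq0 => /eqP.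
have [v [gv ->]] := hclass_surj z; have [x Px] := Ptot v gv.
exists x; apply/hclassP.
apply: (P0 _ _ (gB _ _ (gw x) gv) (PB _ _ _ _ (Pw x) Px)).1; exact: subrr.
Qed.

Lemma homology_iso_rel (R : pzRingType) (U V W U' V' W' : lmodType R)
    (f : {linear U -> V}) (g : {linear V -> W})
    (f' : {linear U' -> V'}) (g' : {linear V' -> W'}) (P : V -> V' -> Prop) :
    (forall a v v' x x', P v x -> P v' x' -> P (a *: v + v') (a *: x + x')) ->
    (forall v, g v = 0 -> exists x, g' x = 0 /\ P v x) ->
    (forall x, g' x = 0 -> exists v, g v = 0 /\ P v x) ->
    (forall v x, g v = 0 -> g' x = 0 -> P v x ->
       ((exists u, f' u = x) <-> exists u, f u = v)) ->
  isomorphic (homology f g) (homology f' g').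
Proof.
move=> Plin Ptot Psurj P0.
(* A cycle is related to the classes of the cycles related to it. *)
apply: (homology_rel_iso (P := fun v z =>
  exists x (gx : g' x = 0), P v x /\ z = hclass f' gx)).
- move=> a v v' _ _ [x [gx [Px ->]]] [x' [gx' [Px' ->]]].
  have gxx' : g' (a *: x + x') = 0 by rewrite linearP gx gx' scaler0 addr0.
  exists (a *: x + x'), gxx'; split; first exact: Plin.
  by rewrite -(hclass_lin f' gx gx' gxx').
- move=> v /Ptot[x [gx Px]]; exists (hclass f' gx), x, gx; by [].
- move=> z; have [x [gx ->]] := hclass_surj z.
  have [v [gv Pv]] := Psurj x gx; exists v; split=> //; by exists x, gx.
- move=> v _ gv [x [gx [Px ->]]]; rewrite hclass_eq0; exact: P0.
Qed.

Lemma homology_iso_chain (R : pzRingType) (U V W U' V' W' : lmodType R)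
    (f : {linear U -> V}) (g : {linear V -> W})
    (f' : {linear U' -> V'}) (g' : {linear V' -> W'})
    (a : {linear U -> U'}) (b : {linear V -> V'}) (c : {linear W -> W'}) :
    bijective a -> bijective b -> bijective c ->
    (forall u, b (f u) = f' (a u)) -> (forall v, c (g v) = g' (b v)) ->
  isomorphic (homology f g) (homology f' g').
Proof.
move=> ba bb bc bf cg; apply: (homology_iso_rel (P := fun v x => b v = x)).
- by move=> k v v' x x' <- <-; rewrite linearP.
- by move=> v gv; exists (b v); rewrite -cg gv linear0.
- move=> x gx; have [v bv] := bij_surj bb x; exists v; split=> //.
  by apply: (bij_inj bc); rewrite cg bv gx linear0.
- move=> v x gv gx bv; split=> -[u fu].
    have [u' au] := bij_surj ba u; exists u'; apply: (bij_inj bb).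
    by rewrite bf au fu bv.
  by exists (a u); rewrite -bf fu.
Qed.

(** * Exactness of tensor products *)

Section TensorFunctor.
Variable R : comPzRingType.
Implicit Types M N U V W T F : lmodType R.

Lemma tpure0l M N (n : N) : tpure (0 : M) n = 0.
Proof. by rewrite -(scale0r (0 : M)) tpureZl scale0r. Qed.

Lemma tpure0r M N (m : M) : tpure m (0 : N) = 0.
Proof. by rewrite -(scale0r (0 : N)) tpureZr scale0r. Qed.

Lemma tensor_mapE M N M' N' (f : {linear M -> M'}) (g : {linear N -> N'}) m n :
  tensor_map f g (tpure m n) = tpure (f m) (g n).
Proof. exact: tensor_map_pure. Qed.

Lemma tensor_map_comp M N M1 N1 M2 N2
    (f : {linear M -> M1}) (g : {linear N -> N1})
    (f' : {linear M1 -> M2}) (g' : {linear N1 -> N2})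
    (h : {linear M -> M2}) (k : {linear N -> N2}) :
    (forall m, f' (f m) = h m) -> (forall n, g' (g n) = k n) ->
  forall x, tensor_map f' g' (tensor_map f g x) = tensor_map h k x.
Proof.
move=> fh gk; elim/tensor_ind => [|m n x IHx]; first by rewrite !linear0.
by rewrite !linearD /= IHx !tensor_mapE fh gk.
Qed.

Lemma tensor_map_id M N (f : {linear M -> M}) (g : {linear N -> N}) :
    (forall m, f m = m) -> (forall n, g n = n) -> forall x, tensor_map f g x = x.
Proof.
move=> fh gk; elim/tensor_ind => [|m n x IHx]; first by rewrite !linear0.
by rewrite !linearD /= IHx !tensor_mapE fh gk.
Qed.

Lemma tensor_map_square M N M1 N1 M2 N2 M3 N3
    (f : {linear M -> M1}) (g : {linear N -> N1})
    (f' : {linear M1 -> M3}) (g' : {linear N1 -> N3})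
    (h : {linear M -> M2}) (k : {linear N -> N2})
    (h' : {linear M2 -> M3}) (k' : {linear N2 -> N3}) :
    (forall m, f' (f m) = h' (h m)) -> (forall n, g' (g n) = k' (k n)) ->
  forall x, tensor_map f' g' (tensor_map f g x) =
            tensor_map h' k' (tensor_map h k x).
Proof.
move=> fh gk; elim/tensor_ind => [|m n x IHx]; first by rewrite !linear0.
by rewrite !linearD /= IHx !tensor_mapE fh gk.
Qed.

Lemma tensor_map_bij M N M1 N1 (f : {linear M -> M1}) (g : {linear N -> N1}) :
  bijective f -> bijective g -> bijective (tensor_map f g).
Proof.
move=> /bij_linear_inv[f' [ff' f'f]] /bij_linear_inv[g' [gg' g'g]].
exists (tensor_map f' g') => x.
  by rewrite (@tensor_map_comp _ _ _ _ _ _ _ _ _ _ (idl M) (idl N)) ?tensor_map_id.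
by rewrite (@tensor_map_comp _ _ _ _ _ _ _ _ _ _ (idl M1) (idl N1)) ?tensor_map_id.
Qed.

Lemma tensor_map_surj T U V (g : {linear U -> V}) :
  (forall v, exists u, g u = v) ->
  forall y, exists x, tensor_map (idl T) g x = y.
Proof.
move=> g_surj; elim/tensor_ind => [|t v y [x <-]]; first by exists 0; rewrite linear0.
have [u <-] := g_surj v; exists (tpure t u + x).
by rewrite linearD /= tensor_mapE.
Qed.

(** The pairing [(t, g v) |-> t (x) v] is well defined modulo the image of
    [T (x) f], so it gives a left inverse of the map that [T (x) g] induces on the
    cokernel of [T (x) f]. *)
Lemma tensor_right_exact T U V W (f : {linear U -> V}) (g : {linear V -> W}) :
    (forall v, g v = 0 -> exists u, f u = v) -> (forall w, exists v, g v = w) ->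
  forall z, tensor_map (idl T) g z = 0 -> exists y, tensor_map (idl T) f y = z.
Proof.
move=> fg_exact g_surj.
pose s w := sval (cid (g_surj w)).
have gs w : g (s w) = w by exact: (svalP (cid (g_surj w))).
pose I : submodClosed (tensor T V) := im_pred (tensor_map (idl T) f).
pose b (t : T) (w : W) : quotmod I := quotmod_pi I (tpure t (s w)).
have piE t v v' : g v = g v' ->
    quotmod_pi I (tpure t v) = quotmod_pi I (tpure t v').
  move=> /eqP; rewrite -subr_eq0 -linearB => /eqP/fg_exact[u fu].
  apply/quotmod_piP/asboolP; exists (tpure t u); rewrite [LHS]tensor_mapE fu.
  by rewrite tpureDr -scaleN1r tpureZr scaleN1r.
have b_linl w : linear (b^~ w).
  by move=> a t t'; rewrite /b tpureDl tpureZl linearP.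
have b_linr t : linear (b t).
  move=> a w w'; rewrite /b -linearP -tpureZr -tpureDr; apply: piE.
  by rewrite linearP !gs.
have [q qE] := tensor_lift b_linl b_linr.
have qP z : q (tensor_map (idl T) g z) = quotmod_pi I z.
  elim/tensor_ind: z => [|t v z IHz]; first by rewrite !linear0.
  rewrite !linearD /= IHz tensor_mapE qE; congr (_ + _); apply: piE.
  exact: gs.
move=> z gz; have := qP z; rewrite gz linear0 => /esym.
by rewrite -(linear0 (quotmod_pi I)) => /quotmod_piP/asboolP; rewrite subr0.
Qed.

Lemma tensor_swap_exists M N :
  exists s : {linear tensor M N -> tensor N M}, forall m n, s (tpure m n) = tpure n m.
Proof.
apply: tensor_lift => [n a m m'|m a n n']; first by rewrite tpureDr tpureZr.
by rewrite tpureDl tpureZl.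
Qed.

Definition tensor_swap M N : {linear tensor M N -> tensor N M} :=
  sval (cid (tensor_swap_exists M N)).

Lemma tensor_swapE M N (m : M) (n : N) : tensor_swap M N (tpure m n) = tpure n m.
Proof. exact: (svalP (cid (tensor_swap_exists M N))). Qed.

Lemma tensor_swapK M N : cancel (tensor_swap M N) (tensor_swap N M).
Proof.
elim/tensor_ind => [|m n x IHx]; first by rewrite !linear0.
by rewrite !linearD IHx !tensor_swapE.
Qed.

Lemma tensor_swap_map M N M' N' (f : {linear M -> M'}) (g : {linear N -> N'}) x :
  tensor_swap _ _ (tensor_map f g x) = tensor_map g f (tensor_swap _ _ x).
Proof.
elim/tensor_ind: x => [|m n x IHx]; first by rewrite !linear0.
by rewrite !linearD /= IHx tensor_mapE !tensor_swapE tensor_mapE.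
Qed.

Lemma tensor_right_exactl T U V W (f : {linear U -> V}) (g : {linear V -> W}) :
    (forall v, g v = 0 -> exists u, f u = v) -> (forall w, exists v, g v = w) ->
  forall z, tensor_map g (idl T) z = 0 -> exists y, tensor_map f (idl T) y = z.
Proof.
move=> fg_exact g_surj z gz.
have [|y fy] := tensor_right_exact (T := T) fg_exact g_surj (z := tensor_swap _ _ z).
  by rewrite -tensor_swap_map gz linear0.
exists (tensor_swap _ _ y); rewrite -tensor_swap_map fy; exact: tensor_swapK.
Qed.

Lemma tensor_map_surjl T U V (g : {linear U -> V}) :
  (forall v, exists u, g u = v) ->
  forall y, exists x, tensor_map g (idl T) x = y.
Proof.
move=> g_surj y; have [x xy] := tensor_map_surj (T := T) g_surj (tensor_swap _ _ y).
exists (tensor_swap _ _ x); rewrite -tensor_swap_map xy; exact: tensor_swapK.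
Qed.

Definition submodule_incl V (U : submodClosed V) : {linear submodule U -> V} :=
  linmap (fun a x y => linearP (val : {linear submodule U -> V}) a x y).

Lemma submodule_inclP V (U : submodClosed V) v :
  v \in U <-> exists x, submodule_incl U x = v.
Proof.
split=> [Uv|[x <-]]; last exact: submodule_valP.
by exists (Submodule Uv).
Qed.

Lemma submodule_incl_inj V (U : submodClosed V) : injective (submodule_incl U).
Proof. exact: val_inj. Qed.

Lemma corestrict U V (I : submodClosed V) (f : {linear U -> V}) :
  (forall u, f u \in I) ->
  exists f' : {linear U -> submodule I}, forall u, submodule_incl I (f' u) = f u.
Proof.
move=> fI; have f_lin : linear (fun u => Submodule (fI u)).
  by move=> a x y; apply: val_inj; exact: linearP.
by exists (linmap f_lin).
Qed.

(** Factor [g] through its image: the surjection onto the image is handled by right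
    exactness, and the inclusion of the image by flatness. *)
Lemma flat_exact F U V W (f : {linear U -> V}) (g : {linear V -> W}) : flat F ->
    (forall v, g v = 0 -> exists u, f u = v) ->
  forall z, tensor_map (idl F) g z = 0 -> exists y, tensor_map (idl F) f y = z.
Proof.
move=> flatF fg_exact z gz.
have [|g' g'E] := corestrict (I := im_pred g) (f := g).
  by move=> v; apply/asboolP; exists v.
apply: (@tensor_right_exact F U V _ f g').
- by move=> v g'v; apply: fg_exact; rewrite -g'E g'v linear0.
- move=> w; have /asboolP[v gv] := submodule_valP w; exists v.
  by apply: submodule_incl_inj; rewrite g'E.
- apply: (flatF _ _ _ (@submodule_incl_inj _ _)); rewrite linear0.
  by rewrite (tensor_map_comp (h := idl F) (k := g)).
Qed.

Lemma flat_exactl F U V W (f : {linear U -> V}) (g : {linear V -> W}) : flat F ->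
    (forall v, g v = 0 -> exists u, f u = v) ->
  forall z, tensor_map g (idl F) z = 0 -> exists y, tensor_map f (idl F) y = z.
Proof.
move=> flatF fg_exact z gz.
have [|y fy] := flat_exact flatF fg_exact (z := tensor_swap _ _ z).
  by rewrite -tensor_swap_map gz linear0.
exists (tensor_swap _ _ y); rewrite -tensor_swap_map fy; exact: tensor_swapK.
Qed.

Lemma flat_retract F F' (i : {linear F -> F'}) (p : {linear F' -> F}) :
  cancel i p -> flat F' -> flat F.
Proof.
move=> ip flatF' U V g g_inj; apply: linear_inj => x gx.
rewrite -(tensor_map_id (f := p \o i) (g := idl U) ip (frefl _) x).
rewrite -(tensor_map_comp (f := i) (f' := p) (g := idl U) (g' := idl U)) //.
suff -> : tensor_map i (idl U) x = 0 by rewrite linear0.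
apply: (flatF' _ _ _ g_inj); rewrite linear0.
by rewrite (tensor_map_square (h := idl F) (k := g) (h' := i) (k' := idl V)) ?gx ?linear0.
Qed.

Lemma flat_iso F F' : isomorphic F F' -> flat F' -> flat F.
Proof. by case=> f /bij_linear_inv[g [fg gf]]; exact: flat_retract fg. Qed.

End TensorFunctor.

(** * Free modules, and flatness of projective modules *)

Section FreeModule.
Variables (R : comPzRingType) (M : lmodType R).

Lemma big_support (I : eqType) (V : nmodType) (F : I -> V) (s s' : seq I) :
    uniq s -> uniq s' -> {subset s <= s'} -> (forall i, i \notin s -> F i = 0) ->
  \sum_(i <- s') F i = \sum_(i <- s) F i.
Proof.
move=> us us' ss' F0; rewrite (bigID (mem s)) /= [X in _ + X]big1 // addr0.
rewrite -big_filter; apply/perm_big/uniq_perm; rewrite ?filter_uniq // => i.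
by rewrite mem_filter andb_idr // => /ss'.
Qed.

(** The free module on the set [M] consists of the pairs [(f, x)] of a finitely
    supported [f] and the sum [x] of the [f b *: b].  Carrying [x] along makes the
    evaluation map onto [M] a mere projection. *)
Definition free_pred : {pred (M -> R^o) * M} := [pred x |
  `[< exists s : seq M, [/\ uniq s, forall b, b \notin s -> x.1 b = 0 &
        x.2 = \sum_(b <- s) x.1 b *: b] >]].

Fact free_pred_submod : subsemimod_closed free_pred.
Proof.
split; first split.
- by apply/asboolP; exists [::]; split=> //; rewrite big_nil.
- move=> [f x] [f' x'] /asboolP[s /= [us f0 ->]] /asboolP[s' /= [us' f0' ->]].
  apply/asboolP; exists (undup (s ++ s')); split=> /= [|b|].
  + exact: undup_uniq.
  + rewrite mem_undup mem_cat negb_or => /andP[bs bs'].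
    by rewrite /= -[LHS]/(f b + f' b) f0 // f0' // addr0.
  + under [RHS]eq_bigr do rewrite -[(f + f') _]/(f _ + f' _) scalerDl.
    rewrite big_split /=; congr (_ + _); apply/esym/big_support;
      rewrite ?undup_uniq // => b; rewrite ?mem_undup ?mem_cat => hb.
    * by rewrite hb.
    * by rewrite f0 // scale0r.
    * by rewrite hb orbT.
    * by rewrite f0' // scale0r.
- move=> a [f x] /asboolP[s /= [us f0 ->]]; apply/asboolP; exists s; split=> //=.
    by move=> b bs; rewrite -[LHS]/(a * f b) f0 // mulr0.
  by rewrite scaler_sumr; apply: eq_bigr => b _; rewrite scalerA.
Qed.
HB.instance Definition _ :=
  GRing.isSubmodClosed.Build R ((M -> R^o) * M)%type free_pred free_pred_submod.

Definition free_module : lmodType R := submodule free_pred.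

Fact free_coord_lin b : linear (fun x : free_module => (val x).1 b : R^o).
Proof. by move=> a x y; rewrite linearP. Qed.
Definition free_coord b : {linear free_module -> R^o} := linmap (free_coord_lin b).

Fact free_eval_lin : linear (fun x : free_module => (val x).2).
Proof. by move=> a x y; rewrite linearP. Qed.
Definition free_eval : {linear free_module -> M} := linmap free_eval_lin.

Lemma free_gen_subproof b : (((fun c => (c == b)%:R) : M -> R^o), b) \in free_pred.
Proof.
apply/asboolP; exists [:: b]; split=> //= [c|].
  by rewrite inE => /negbTE->.
by rewrite big_seq1 eqxx scale1r.
Qed.
Definition free_gen b : free_module := Submodule (free_gen_subproof b).

Lemma free_coord_gen c b : free_coord c (free_gen b) = (c == b)%:R.
Proof. by []. Qed.

Lemma free_eval_gen b : free_eval (free_gen b) = b.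
Proof. by []. Qed.

Lemma free_eval_surj x : exists z, free_eval z = x.
Proof. by exists (free_gen x). Qed.

Lemma free_decomp (x : free_module) : exists s : seq M,
  [/\ uniq s, forall b, b \notin s -> free_coord b x = 0 &
      x = \sum_(b <- s) free_coord b x *: free_gen b].
Proof.
have /asboolP[s [us x0 xE]] := submodule_valP x.
exists s; split=> //; apply: val_inj; rewrite [LHS]surjective_pairing.
rewrite [RHS]surjective_pairing; congr (_, _).
  apply/funext => c; rewrite -[LHS]/(free_coord c x) -[RHS]/(free_coord c _).
  rewrite linear_sum; under eq_bigr do rewrite linearZZ free_coord_gen -[_ *: _]/(_ * _).
  have [cs|cs] := boolP (c \in s).
    rewrite (bigD1_seq c) //= eqxx mulr1 big1 ?addr0 // => b /negbTE.
    by rewrite eq_sym => ->; rewrite mulr0.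
  rewrite big_seq big1 => [|b bs]; first exact: x0.
  have /negbTE-> : c != b by apply: contraNneq cs => ->.
  by rewrite mulr0.
rewrite -[RHS]/(free_eval _) linear_sum [LHS]xE.
by apply: eq_bigr => b _; rewrite linearZZ free_eval_gen.
Qed.

Lemma free_coord_tensor (U : lmodType R) b : exists k : {linear tensor free_module U -> U},
  forall x u, k (tpure x u) = free_coord b x *: u.
Proof.
apply: tensor_lift => [u a x y|x a u v].
  by rewrite linearP scalerDl -scalerA.
by rewrite scalerDr !scalerA mulrC.
Qed.

(** The coordinates with respect to the basis [free_gen] are natural in [U], and an
    element of [free_module (x) U] all of whose coordinates vanish is [0]. *)
Lemma free_flat : flat free_module.
Proof.
move=> U V g g_inj; apply: linear_inj => z gz.
pose k W b := sval (cid (free_coord_tensor W b)).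
have kE W b x u : k W b (tpure x u) = free_coord b x *: u.
  exact: (svalP (cid (free_coord_tensor W b))).
have k_map b x : k V b (tensor_map (idl free_module) g x) = g (k U b x).
  elim/tensor_ind: x => [|x u y IHy]; first by rewrite !linear0.
  by rewrite !linearD /= IHy tensor_mapE !kE linearZZ.
have [s [_ _ ->]] : exists s, [/\ uniq s, forall b, b \notin s -> k U b z = 0 &
    z = \sum_(b <- s) tpure (free_gen b) (k U b z)].
  elim/tensor_ind: z {gz} => [|x u z [s [us z0 zE]]].
    by exists [::]; split=> // [b _|]; rewrite ?linear0 // big_nil.
  have [t [ut x0 xE]] := free_decomp x; exists (undup (t ++ s)).
  have kD b : k U b (tpure x u + z) = free_coord b x *: u + k U b z.
    by rewrite linearD kE.
  split=> [|b|]; first exact: undup_uniq.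
    rewrite mem_undup mem_cat negb_or => /andP[bt bs].
    by rewrite kD x0 // z0 // scale0r addr0.
  under eq_bigr do rewrite kD tpureDr tpureZr -tpureZl.
  rewrite big_split /=; congr (_ + _).
    rewrite [in LHS]xE.
    rewrite -(big_support (s := t) (s' := undup (t ++ s))
               (F := fun b => free_coord b x *: free_gen b)) ?undup_uniq //.
    + by elim/big_rec2: _ => [|b y y' _ <-]; rewrite ?tpure0l ?tpureDl.
    + by move=> b bt; rewrite mem_undup mem_cat bt.
    + by move=> b /x0->; rewrite scale0r.
  rewrite [in LHS]zE; apply/esym/big_support => //; rewrite ?undup_uniq //.
    by move=> b bs; rewrite mem_undup mem_cat bs orbT.
  by move=> b /z0->; rewrite tpure0r.
rewrite big1 // => b _; suff -> : k U b z = 0 by rewrite tpure0r.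
by apply: g_inj; rewrite -k_map gz !linear0.
Qed.

End FreeModule.

(** A projective module is a retract of the free module on its elements. *)
Lemma projective_flat (R : comPzRingType) (P : lmodType R) : projective P -> flat P.
Proof.
move=> projP; have [s sK] := projP _ _ (free_eval P) (idl P) (@free_eval_surj _ P).
exact: (flat_retract (i := s) sK (@free_flat _ P)).
Qed.

Lemma projective_regular (R : comPzRingType) : projective (R^o : lmodType R).
Proof.
move=> U V g f g_surj; have [u gu] := g_surj (f 1).
have h_lin : linear (fun r : R^o => r *: u).
  by move=> a x y; rewrite scalerDl scalerA.
exists (linmap h_lin) => x.
by rewrite linearZZ gu -linearZZ; congr (f _); exact: mulr1.
Qed.

Lemma tensor_regular_iso (R : comPzRingType) (C : lmodType R) :
  isomorphic C (tensor R^o C).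
Proof.
have [||h hE] := @tensor_lift R R^o C C (fun r c => r *: c).
- by move=> n a x y; rewrite scalerDl scalerA.
- by move=> m a x y; rewrite scalerDr !scalerA mulrC.
have f_lin : linear (fun c : C => tpure (1 : R^o) c).
  by move=> a x y /=; rewrite tpureDr tpureZr.
exists (linmap f_lin); exists h => [c|]; first by rewrite hE scale1r.
elim/tensor_ind => [|r c z IHz]; first by rewrite !linear0.
rewrite !linearD IHz hE; congr (_ + _).
by rewrite linearZZ -tpureZl; congr (tpure _ _); exact: mulr1.
Qed.

Lemma PC_self (R : comPzRingType) (C : lmodType R) : PC C C.
Proof.
by exists R^o; split; [exact: projective_regular|exact: tensor_regular_iso].
Qed.

Lemma PC_FC (R : comPzRingType) (C X : lmodType R) : PC C X -> FC C X.
Proof. by case=> P [projP XP]; exists P; split=> //; exact: projective_flat. Qed.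

(** * Finite presentation over a noetherian ring *)

Section Span.
Variables (R : comPzRingType) (M : lmodType R).

Definition lin_closed (P : M -> Prop) : Prop :=
  P 0 /\ forall a x y, P x -> P y -> P (a *: x + y).

Definition closed_pred (P : M -> Prop) of lin_closed P : {pred M} :=
  [pred x | `[< P x >]].

Fact closed_pred_submod P (Pcl : lin_closed P) : subsemimod_closed (closed_pred Pcl).
Proof.
have [P0 PD] := Pcl; split; first split; first exact/asboolP.
  move=> x y /asboolP Px /asboolP Py; apply/asboolP.
  by rewrite -[x]scale1r; apply: PD.
by move=> a x /asboolP Px; apply/asboolP; rewrite -[_ *: _]addr0; apply: PD.
Qed.
HB.instance Definition _ P (Pcl : lin_closed P) :=
  GRing.isSubmodClosed.Build R M (closed_pred Pcl) (closed_pred_submod Pcl).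

(** Peeling off one generator at a time is the form in which spans enter the
    inductions below. *)
Fixpoint span (s : seq M) (y : M) : Prop :=
  if s is x :: s' then exists r z, span s' z /\ y = r *: x + z else y = 0.

Lemma span_closed s : lin_closed (span s).
Proof.
elim: s => [|x s [IH0 IHD]] /=.
  by split=> // a x y -> ->; rewrite scaler0 addr0.
split=> [|a _ _ [r [z [sz ->]]] [r' [z' [sz' ->]]]].
  by exists 0, 0; split=> //; rewrite scale0r addr0.
exists (a * r + r'), (a *: z + z'); split; first exact: IHD.
by rewrite scalerDr scalerA addrACA scalerDl.
Qed.

Lemma span_cat s t x y : span s x -> span t y -> span (s ++ t) (x + y).
Proof.
elim: s x => [|u s IHs] x /=; first by move=> ->; rewrite add0r.
move=> [r [z [sz ->]]] ty; exists r, (z + y); split; first exact: IHs.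
by rewrite addrA.
Qed.

Lemma spanP s x :
  span s x <-> exists c : nat -> R, x = \sum_(i < size s) c i *: s`_i.
Proof.
elim: s x => [|u s IHs] x /=.
  split=> [->|[c ->]]; last by rewrite big_ord0.
  by exists (fun=> 0); rewrite big_ord0.
split=> [[r [z [/IHs[c ->] ->]]]|[c ->]].
  by exists (fun i => if i is j.+1 then c j else r); rewrite big_ord_recl.
rewrite big_ord_recl /=; exists (c 0%N), (\sum_(i < size s) c i.+1 *: s`_i).
by split=> //; apply/IHs; exists (fun i => c i.+1).
Qed.

Lemma span_sum (I : Type) (r : seq I) (c : I -> R) (f : I -> M) :
  span (map f r) (\sum_(i <- r) c i *: f i).
Proof.
elim: r => [|i r IHr] /=; first by rewrite big_nil.
by rewrite big_cons; exists (c i), (\sum_(j <- r) c j *: f j).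
Qed.

End Span.

Lemma span_map (R : comPzRingType) (M M' : lmodType R) (f : {linear M -> M'}) s x :
  span s x -> span (map f s) (f x).
Proof.
elim: s x => [|u s IHs] x /=; first by move=> ->; rewrite linear0.
by move=> [r [z [/IHs sz ->]]]; exists r, (f z); rewrite linearP.
Qed.

(** Hilbert's argument: the coefficients at the first generator of the elements
    of [K] form an ideal; lifting generators of that ideal to [K] reduces the
    claim to the elements of [K] in the span of the remaining generators. *)
Lemma noetherian_span (R : comPzRingType) (M : lmodType R) (s : seq M) :
    noetherian R -> forall K : M -> Prop, lin_closed K ->
    (forall x, K x -> span s x) ->
  exists t : seq M, (forall x, x \in t -> K x) /\ (forall x, K x -> span t x).
Proof.
move=> noethR; elim: s => [|x s IHs] K [K0 KD] Ks.
  by exists [::]; split=> // y /Ks.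
have [s0 sD] := span_closed s.
pose I (r : R^o) := exists z, span s z /\ K (r *: x + z).
have Icl : lin_closed I.
  split; first by exists 0; rewrite scale0r addr0.
  move=> a r r' [z [sz Kz]] [z' [sz' Kz']]; exists (a *: z + z').
  split; first exact: sD.
  by rewrite scalerDl -scalerA addrACA -scalerDr; apply: KD.
have [g gI] := noethR (closed_pred Icl).
have gI' r : I r -> span (map (submodule_incl (closed_pred Icl)) g) r.
  move=> Ir; have Ir' : r \in closed_pred Icl by apply/asboolP.
  have [c cE] := gI (Submodule Ir').
  by apply: (span_map (submodule_incl _) (x := Submodule Ir')); apply/spanP; exists c.
have [ks [Kks ksP]] : exists ks : seq M, (forall k, k \in ks -> K k) /\
    forall r, span (map (submodule_incl (closed_pred Icl)) g) r ->
      exists z, span s z /\ span ks (r *: x + z).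
  elim: (g) => [|[r0 r0I] g' [ks [Kks ksP]]] /=.
    exists [::]; split=> // r ->; exists 0; split=> //.
    by rewrite scale0r addr0.
  have /asboolP[z0 [sz0 Kz0]] := r0I.
  exists (r0 *: x + z0 :: ks); split=> [k|r [a [r' [/ksP[z' [sz' kz']] ->]]]].
    by rewrite inE => /predU1P[->|/Kks].
  exists (a *: z0 + z'); split; first exact: sD.
  exists a, (r' *: x + z'); split=> //.
  by rewrite scalerDl -scalerA scalerDr addrACA.
have [| |t [Kt tP]] := IHs (fun y => K y /\ span s y).
- by split=> // a y y' [Ky sy] [Ky' sy']; split; [exact: KD|exact: sD].
- by move=> y [].
have Ksum u y : (forall k, k \in u -> K k) -> span u y -> K y.
  elim: u y => [|k u IHu] y Ku /=; first by move=> ->.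
  move=> [r [z [uz ->]]]; apply: KD; first by apply: Ku; rewrite mem_head.
  by apply: IHu => // k' k'u; apply: Ku; rewrite inE k'u orbT.
exists (ks ++ t); split=> [k|y Ky].
  by rewrite mem_cat => /orP[/Kks|/Kt[]].
have [r [z [sz yE]]] := Ks y Ky.
have [z' [sz' kz']] := ksP r (gI' r (ex_intro _ z (conj sz (eq_ind _ K Ky _ yE)))).
have -> : y = r *: x + z' + (z - z').
  by rewrite yE -addrA [z' + _]addrC subrK.
apply: span_cat => //; apply: tP.
have sB : span s (z - z').
  by rewrite addrC -scaleN1r; apply: sD.
split=> //; have -> : z - z' = -1 *: (r *: x + z') + y.
  by rewrite yE scaleN1r opprD addrACA addNr add0r addrC.
by apply: KD => //; exact: Ksum kz'.
Qed.

Section Presentation.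
Variable R : comPzRingType.

Definition finitely_presented (C : lmodType R) : Prop :=
  exists n (p : {linear 'rV[R]_n -> C}) m (q : {linear 'rV[R]_m -> 'rV[R]_n}),
  [/\ forall c, exists x, p x = c, forall y, p (q y) = 0 &
      forall x, p x = 0 -> exists y, q y = x].

Fact combination_lin (M : lmodType R) (s : seq M) :
  linear (fun v : 'rV[R]_(size s) => \sum_i v 0 i *: s`_i).
Proof.
move=> a v w; rewrite scaler_sumr -big_split /=; apply: eq_bigr => i _.
by rewrite !mxE scalerDl scalerA.
Qed.

Definition combination (M : lmodType R) (s : seq M) : {linear 'rV[R]_(size s) -> M} :=
  linmap (@combination_lin M s).

Lemma combination_surj (M : lmodType R) (s : seq M) x :
  span s x -> exists v, combination s v = x.
Proof.
move=> /spanP[c ->]; exists (\row_i c i).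
by apply: eq_bigr => i _; rewrite mxE.
Qed.

(** The kernel of a surjection from a finite free module onto [C] is finitely
    generated. *)
Lemma noetherian_presented (C : lmodType R) :
  noetherian R -> finitely_generated C -> finitely_presented C.
Proof.
move=> noethR [s sP]; pose p := combination s.
have [| |t [Kt tP]] := @noetherian_span R _ [seq 'e_j | j <- enum 'I_(size s)]
  noethR (fun x => p x = 0).
- by split=> [|a x y px py]; rewrite ?linear0 // linearP px py scaler0 addr0.
- move=> x _; rewrite [X in span _ X]row_sum_delta -big_enum; exact: span_sum.
exists (size s), p, (size t), (combination t); split.
- by move=> c; apply: combination_surj; apply/spanP.
- move=> y; rewrite [combination t y]/= linear_sum big1 // => i _.
  by rewrite linearZ Kt ?mem_nth //= scaler0.
- by move=> x /tP; exact: combination_surj.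
Qed.

End Presentation.

(** * Homomorphisms into a tensor product *)

Section HomTensor.
Variable R : comPzRingType.
Implicit Types T C D U V W : lmodType R.

Fact hom_eval_lin C V (c : C) : linear (fun h : Hom C V => (h : {linear C -> V}) c).
Proof. by []. Qed.
Definition hom_eval C V (c : C) : {linear Hom C V -> V} := linmap (@hom_eval_lin C V c).

Fact hom_tensor_lin1 T C V (x : tensor T (Hom C V)) :
  linear (fun c => tensor_map (idl T) (hom_eval V c) x).
Proof.
move=> a c c'; elim/tensor_ind: x => [|t h x IHx].
  by rewrite /= !linear0 ?scaler0 ?addr0.
rewrite !linearD /= IHx !tensor_mapE addrACA; congr (_ + _).
by rewrite -tpureZr -tpureDr [hom_eval _ _ _]linearP.
Qed.

Fact hom_tensor_lin T C V :
  linear (fun x : tensor T (Hom C V) => linmap (hom_tensor_lin1 x) : Hom C (tensor T V)).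
Proof. by move=> a x y; apply: HomP => c; exact: linearP. Qed.

(** The map [t (x) h |-> (c |-> t (x) h c)]. *)
Definition hom_tensor T C V : {linear tensor T (Hom C V) -> Hom C (tensor T V)} :=
  linmap (@hom_tensor_lin T C V).

Lemma hom_tensorE T C V (x : tensor T (Hom C V)) c :
  (hom_tensor T C V x : {linear _ -> _}) c = tensor_map (idl T) (hom_eval V c) x.
Proof. by []. Qed.

Lemma hom_tensor_postcomp T C V W (g : {linear V -> W}) x :
  hom_tensor T C W (tensor_map (idl T) (hom_postcomp C g) x) =
  hom_postcomp C (tensor_map (idl T) g) (hom_tensor T C V x).
Proof.
by apply: HomP => c; rewrite hom_tensorE; apply: tensor_map_square.
Qed.

Lemma hom_tensor_precomp T C D V (g : {linear C -> D}) x :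
  hom_tensor T C V (tensor_map (idl T) (hom_precomp V g) x) =
  hom_precomp (tensor T V) g (hom_tensor T D V x).
Proof.
by apply: HomP => c; rewrite hom_tensorE; apply: tensor_map_comp.
Qed.

Lemma tensor_map_sum T U V n (g : {linear U -> V}) (h : 'I_n -> {linear U -> V}) x :
    (forall u, g u = \sum_j h j u) ->
  tensor_map (idl T) g x = \sum_j tensor_map (idl T) (h j) x.
Proof.
move=> gh; elim/tensor_ind: x => [|t u x IHx].
  by rewrite linear0 big1 // => j _; rewrite linear0.
rewrite linearD /= IHx; under [RHS]eq_bigr do rewrite linearD /=.
rewrite big_split /=; congr (_ + _); rewrite tensor_mapE gh.
under [RHS]eq_bigr do rewrite tensor_mapE.
by elim/big_rec2: _ => [|j y y' _ <-]; rewrite ?tpure0r ?tpureDr.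
Qed.

Lemma tensor_map_scale T V (g : {linear V -> V}) a x :
  (forall v, g v = a *: v) -> tensor_map (idl T) g x = a *: x.
Proof.
move=> ga; elim/tensor_ind: x => [|t u x IHx]; first by rewrite linear0 scaler0.
by rewrite linearD /= IHx tensor_mapE ga tpureZr scalerDr.
Qed.

Fact hom_row_lin1 n V (j : 'I_n) (v : V) : linear (fun r : 'rV[R]_n => r 0 j *: v).
Proof. by move=> a r r'; rewrite !mxE scalerDl scalerA. Qed.
Fact hom_row_lin n V (j : 'I_n) :
  linear (fun v : V => linmap (hom_row_lin1 j v) : Hom 'rV[R]_n V).
Proof.
by move=> a v v'; apply: HomP => r /=; rewrite scalerDr !scalerA mulrC.
Qed.
Definition hom_row n V (j : 'I_n) : {linear V -> Hom 'rV[R]_n V} :=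
  linmap (@hom_row_lin n V j).

(** Evaluation at the standard basis, with the [hom_row j] as inverse, identifies
    [Hom(R^n, -)] with an [n]-fold direct sum, which tensoring preserves. *)
Lemma hom_tensor_row T n V : bijective (hom_tensor T 'rV[R]_n V).
Proof.
apply: inj_surj_bij => [|y].
  apply: linear_inj => z hz.
  rewrite -[z](@tensor_map_id R _ _ (idl T) (idl (Hom 'rV[R]_n V)) (frefl _) (frefl _)).
  rewrite (tensor_map_sum (h := fun j => hom_row V j \o hom_eval V 'e_j)).
    rewrite big1 // => j _.
    rewrite -(tensor_map_comp (f := idl T) (f' := idl T)
                (g := hom_eval V 'e_j) (g' := hom_row V j)) //.
    by rewrite -hom_tensorE hz /= linear0.
  move=> h; apply: HomP => r; rewrite {1}(row_sum_delta r).
  rewrite linear_sum -[RHS]/(hom_eval V r _) linear_sum.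
  by apply: eq_bigr => j _; rewrite linearZZ.
exists (\sum_j tensor_map (idl T) (hom_row V j) ((y : {linear _ -> _}) 'e_j)).
apply: HomP => r; rewrite hom_tensorE linear_sum {2}(row_sum_delta r) linear_sum.
apply: eq_bigr => j _; rewrite linearZZ.
rewrite [LHS](tensor_map_comp (h := idl T) (k := hom_eval V r \o hom_row V j)) //.
exact: tensor_map_scale.
Qed.

Lemma factor_surj U V W (p : {linear U -> V}) (h : {linear U -> W}) :
    (forall v, exists u, p u = v) -> (forall u, p u = 0 -> h u = 0) ->
  exists h' : {linear V -> W}, forall u, h' (p u) = h u.
Proof.
move=> p_surj ph; pose s v := sval (cid (p_surj v)).
have ps v : p (s v) = v by exact: (svalP (cid (p_surj v))).
have hE u u' : p u = p u' -> h u = h u'.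
  move=> /eqP; rewrite -subr_eq0 -linearB => /eqP/ph/eqP.
  by rewrite linearB subr_eq0 => /eqP.
have h'_lin : linear (fun v => h (s v)).
  by move=> a v v'; rewrite -linearP; apply: hE; rewrite linearP !ps.
by exists (linmap h'_lin) => u; apply: hE.
Qed.

(** Both sides of [hom_tensor] are left exact in the presentation of [C], because
    [T] is flat, so the case of finite free modules suffices. *)
Lemma hom_tensor_bij T C V :
  flat T -> finitely_presented C -> bijective (hom_tensor T C V).
Proof.
move=> flatT [n [p [m [q [p_surj pq qp]]]]].
have pre_inj W : injective (hom_precomp W p).
  move=> f f' /(congr1 (fun h : Hom _ _ => (h : {linear _ -> _}) : _ -> _)) ff'.
  by apply: HomP => c; have [x <-] := p_surj c; exact: (congr1 (fun h => h x) ff').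
apply: inj_surj_bij => [|y].
  apply: linear_inj => z hz; apply: (flatT _ _ _ (@pre_inj V)); rewrite linear0.
  apply: (bij_inj (hom_tensor_row T n V)).
  by rewrite hom_tensor_precomp hz !linear0.
have [u uE] := bij_surj (hom_tensor_row T n V) (hom_precomp (tensor T V) p y).
have pre_exact (h : Hom 'rV[R]_n V) : hom_precomp V q h = 0 ->
    exists h', hom_precomp V p h' = h.
  move=> qh; have [|h' h'E] := factor_surj (p := p) (h := h) p_surj.
    move=> x /qp[w <-].
    exact: (congr1 (fun k : Hom _ _ => (k : {linear _ -> _}) w) qh).
  by exists h'; apply: HomP.
have [|z zE] := flat_exact flatT pre_exact (z := u).
  apply: (bij_inj (hom_tensor_row T m V)); rewrite hom_tensor_precomp uE linear0.
  by apply: HomP => w /=; rewrite pq linear0.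
by exists z; apply: pre_inj; rewrite -hom_tensor_precomp zE uE.
Qed.

End HomTensor.

(** * Flat resolutions compute Tor *)

Section Tor.
Variable R : comPzRingType.
Implicit Types A B M N : lmodType R.

Lemma exact_complexP (X : complex R) : exact_complex X <->
  forall n v, complex_out X n v = 0 -> exists u, complex_d X n u = v.
Proof. by split=> [H n|H n]; apply/homology_eq0P; exact: H. Qed.

Definition flat_resolution A (F : augmented A) : Prop :=
  (forall n, flat (F n)) /\ exact_complex (augment F).

Section Resolution.
Variables (A : lmodType R) (F : augmented A) (resF : flat_resolution F).

Let flatF : forall n, flat (F n). Proof. exact: resF.1. Qed.

Lemma resolution_surj a : exists x, aug_map F x = a.
Proof. by apply: ((exact_complexP _).1 resF.2 0%N a). Qed.

Lemma resolution_exact0 x : aug_map F x = 0 -> exists y, complex_d F 0 y = x.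
Proof. exact: ((exact_complexP _).1 resF.2 1%N x). Qed.

Lemma resolution_exactS n x :
  complex_d F n x = 0 -> exists y, complex_d F n.+1 y = x.
Proof. exact: ((exact_complexP _).1 resF.2 n.+2 x). Qed.

(** Right exactness of [- (x) B] applied to [F_1 -> F_0 -> A -> 0]. *)
Lemma resolution_H0 B :
  isomorphic (complex_homology (tensor_complex F B) 0) (tensor A B).
Proof.
apply: (homology_rel_iso (P := fun z w => tensor_map (aug_map F) (idl B) z = w)).
- by move=> a v v' x x' <- <-; rewrite linearP.
- by move=> v _; exists (tensor_map (aug_map F) (idl B) v).
- by move=> x; have [v vx] := tensor_map_surjl (T := B) resolution_surj x; exists v.
- move=> v _ _ <-; split=> [|[u <-]].
    exact: (tensor_right_exactl resolution_exact0 resolution_surj).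
  rewrite (tensor_map_comp (h := (\0 : F 1%N -> A)) (k := idl B)) //; last exact: aug_mapd.
  elim/tensor_ind: u => [|m n x IHx]; first by rewrite linear0.
  by rewrite linearD /= IHx tensor_mapE tpure0l addr0.
Qed.

Section Shift.
Variable B : lmodType R.

Definition syzygy : lmodType R := submodule (ker_pred (free_eval B)).
Definition syzygy_incl : {linear syzygy -> free_module B} := submodule_incl _.

Lemma syzygy_exact v : free_eval B v = 0 -> exists u, syzygy_incl u = v.
Proof. by move=> v0; apply/submodule_inclP; rewrite inE v0. Qed.

Lemma syzygy_eval u : free_eval B (syzygy_incl u) = 0.
Proof. by have := submodule_valP u; rewrite inE => /eqP. Qed.

Lemma tensor_eval_incl T (x : tensor T syzygy) :
  tensor_map (idl T) (free_eval B) (tensor_map (idl T) syzygy_incl x) = 0.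
Proof.
rewrite (tensor_map_comp (h := idl T) (k := (\0 : syzygy -> B))) //; last exact: syzygy_eval.
elim/tensor_ind: x => [|m n x IHx]; first by rewrite linear0.
by rewrite linearD /= IHx tensor_mapE tpure0r addr0.
Qed.

Lemma syzygy_incl_inj n : injective (tensor_map (idl (F n)) syzygy_incl).
Proof. by apply: flatF; exact: submodule_incl_inj. Qed.

Lemma tensor_d_nat n (U V : lmodType R) (g : {linear U -> V}) x :
  tensor_map (complex_d F n) (idl V) (tensor_map (idl (F n.+1)) g x) =
  tensor_map (idl (F n)) g (tensor_map (complex_d F n) (idl U) x).
Proof. exact: tensor_map_square. Qed.

(** The connecting homomorphism of [0 -> K -> L -> B -> 0], with [L] free on [B],
    embeds [H_(i+1)(F (x) B)] into [H_i(F (x) K)] because [F (x) L] is exact in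
    degree [i+1].  Its image consists of the classes that vanish in
    [H_i(F (x) L)], and [q] is any map whose kernel is the module of their
    representatives: the differential for [i > 0], a map into [A (x) L] for
    [i = 0]. *)
Lemma dimension_shift i (W : lmodType R) (q : {linear tensor (F i) syzygy -> W}) :
    (forall x, q x = 0 <-> exists y,
       tensor_map (complex_d F i) (idl (free_module B)) y =
       tensor_map (idl (F i)) syzygy_incl x) ->
  isomorphic (complex_homology (tensor_complex F B) i.+1)
    (homology (tensor_map (complex_d F i) (idl syzygy)) q).
Proof.
move=> qP; apply: (homology_iso_rel (P := fun z x => exists y,
  tensor_map (idl (F i.+1)) (free_eval B) y = z /\
  tensor_map (complex_d F i) (idl (free_module B)) y =
    tensor_map (idl (F i)) syzygy_incl x)).
- move=> a _ _ x x' [y [<- yx]] [y' [<- yx']]; exists (a *: y + y').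
  split; first exact: linearP.
  by rewrite [LHS]linearP [RHS]linearP; congr (_ *: _ + _).
- move=> z dz; have [y yz] := tensor_map_surj (T := F i.+1) (@free_eval_surj _ B) z.
  have [|x xy] := tensor_right_exact (T := F i) syzygy_exact (@free_eval_surj _ B)
    (z := tensor_map (complex_d F i) (idl (free_module B)) y).
    by rewrite -tensor_d_nat yz; exact: dz.
  by exists x; split; [apply/qP; exists y|exists y].
- move=> x /qP[y yx]; exists (tensor_map (idl (F i.+1)) (free_eval B) y).
  split; last by exists y.
  by rewrite [LHS]tensor_d_nat yx tensor_eval_incl.
- move=> z x dz qx [y [yz yx]]; split=> [[u ux]|[w wz]].
    have [|y' y'E] := flat_exactl (@free_flat _ B) (@resolution_exactS i)
        (z := y - tensor_map (idl (F i.+1)) syzygy_incl u).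
      by rewrite linearB [X in X - _]yx [X in _ - X]tensor_d_nat ux subrr.
    exists (tensor_map (idl (F i.+2)) (free_eval B) y').
    rewrite [LHS]tensor_d_nat y'E linearB [X in _ - X]tensor_eval_incl subr0.
    exact: yz.
  have [y' y'w] := tensor_map_surj (T := F i.+2) (@free_eval_surj _ B) w.
  have [|u uE] := tensor_right_exact (T := F i.+1) syzygy_exact (@free_eval_surj _ B)
      (z := y - tensor_map (complex_d F i.+1) (idl (free_module B)) y').
    by rewrite linearB [X in X - _]yz [X in _ - X](esym (tensor_d_nat _ _)) y'w wz subrr.
  exists u; apply: syzygy_incl_inj; rewrite -tensor_d_nat uE linearB [X in X - _]yx.
  by rewrite [X in _ - X](@tensor_complex_dd _ F (free_module B)) subr0.
Qed.

(** [H_1(F (x) B)] is the kernel of [A (x) K -> A (x) L], written here as a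
    homology module with zero incoming map. *)
Lemma dimension_shift0 : isomorphic (complex_homology (tensor_complex F B) 1)
  (homology (\0 : tensor A syzygy -> tensor A syzygy)
            (tensor_map (idl A) syzygy_incl)).
Proof.
have qE x : tensor_map (aug_map F) syzygy_incl x =
    tensor_map (aug_map F) (idl (free_module B)) (tensor_map (idl (F 0%N)) syzygy_incl x).
  by rewrite (tensor_map_comp (h := aug_map F) (k := syzygy_incl)).
apply: isomorphic_trans (dimension_shift (q := tensor_map (aug_map F) syzygy_incl) _) _.
  move=> x; rewrite [X in X = 0]qE; split=> [|[y <-]].
    exact: (tensor_right_exactl resolution_exact0 resolution_surj).
  rewrite (tensor_map_comp (h := (\0 : F 1%N -> A)) (k := idl (free_module B))) //; last exact: aug_mapd.
  elim/tensor_ind: y => [|m n y IHy]; first by rewrite linear0.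
  by rewrite linearD /= IHy tensor_mapE tpure0l addr0.
have q'E x : tensor_map (aug_map F) syzygy_incl x =
    tensor_map (idl A) syzygy_incl (tensor_map (aug_map F) (idl syzygy) x).
  by rewrite (tensor_map_comp (h := aug_map F) (k := syzygy_incl)).
apply: (homology_iso_rel (P := fun x w => tensor_map (aug_map F) (idl syzygy) x = w)).
- by move=> a v v' x x' <- <-; rewrite linearP.
- by move=> x qx; exists (tensor_map (aug_map F) (idl syzygy) x); split; first exact: etrans (esym (q'E x)) qx.
- move=> w wi; have [x xw] := tensor_map_surjl (T := syzygy) resolution_surj w.
  by exists x; split=> //; rewrite [LHS]q'E xw.
- move=> x _ _ _ <-; split=> [[u /esym ux]|[u <-]].
    exact: (tensor_right_exactl resolution_exact0 resolution_surj).
  exists 0; rewrite /=.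
  rewrite (tensor_map_comp (h := (\0 : F 1%N -> A)) (k := idl syzygy)) //; last exact: aug_mapd.
  elim/tensor_ind: u => [|m n y IHy]; first by rewrite linear0.
  by rewrite linearD /= -IHy tensor_mapE tpure0l addr0.
Qed.

Lemma dimension_shiftS i : isomorphic (complex_homology (tensor_complex F B) i.+2)
  (complex_homology (tensor_complex F syzygy) i.+1).
Proof.
apply: dimension_shift => x; split=> [dx|[y yx]].
  apply: (flat_exactl (@free_flat _ B) (@resolution_exactS i)).
  by rewrite tensor_d_nat [X in tensor_map _ _ X]dx linear0.
apply: syzygy_incl_inj; rewrite -tensor_d_nat -yx linear0.
exact: (@tensor_complex_dd _ F (free_module B)).
Qed.

End Shift.
End Resolution.

(** Both sides reduce, after [i] shifts, to modules built from [A] and the syzygies of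
    [B] alone. *)
Lemma flat_resolution_independence A (F F' : augmented A) :
    flat_resolution F -> flat_resolution F' -> forall B i,
  isomorphic (complex_homology (tensor_complex F B) i)
             (complex_homology (tensor_complex F' B) i).
Proof.
move=> resF resF' B i; elim: i B => [|[|i] IHi] B.
- by apply: isomorphic_trans (resolution_H0 resF B) _;
    apply: isomorphic_sym; exact: resolution_H0.
- by apply: isomorphic_trans (dimension_shift0 resF B) _;
    apply: isomorphic_sym; exact: dimension_shift0.
- apply: isomorphic_trans (dimension_shiftS resF B i) _.
  by apply: isomorphic_trans (IHi _) _; apply: isomorphic_sym; exact: dimension_shiftS.
Qed.

End Tor.

(** * Resolutions by modules F (x) C *)

Section RelativeResolution.
Variables (R : comPzRingType) (C : lmodType R).
Hypotheses (fpC : finitely_presented C) (homothC : bijective (@homothety R C)).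
Implicit Types F M N X Y : lmodType R.

Fact homothety_lin : linear (homothety C : R^o -> Hom C C).
Proof.
by move=> a r r'; apply: HomP => c; rewrite /homothety /= scalerDl scalerA.
Qed.

Fact unit_map_lin1 F (f : F) : linear (fun c : C => tpure f c).
Proof. by move=> a c c'; rewrite tpureDr tpureZr. Qed.
Fact unit_map_lin F : linear (fun f : F => linmap (unit_map_lin1 f) : Hom C (tensor F C)).
Proof. by move=> a f f'; apply: HomP => c /=; rewrite tpureDl tpureZl. Qed.

Definition unit_map F : {linear F -> Hom C (tensor F C)} := linmap (@unit_map_lin F).

Lemma unit_mapE F (f : F) :
  unit_map F f = hom_tensor F C C (tpure f (homothety C 1)).
Proof.
by apply: HomP => c; rewrite hom_tensorE tensor_mapE; congr (tpure _ _); rewrite /= scale1r.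
Qed.

(** For flat [F], this is [F = F (x) R = F (x) Hom(C, C) = Hom(C, F (x) C)]. *)
Lemma unit_map_bij F : flat F -> bijective (unit_map F).
Proof.
move=> flatF; have bij_ht := hom_tensor_bij C flatF fpC.
have [k [hk kh]] := bij_linear_inv (f := linmap homothety_lin) homothC.
apply: inj_surj_bij => [|y].
  apply: linear_inj => f; rewrite unit_mapE => hf0.
  have f0 : tpure f (homothety C 1) = 0.
    by apply: (bij_inj bij_ht); rewrite hf0 linear0.
  have [||u uE] := @tensor_lift R F (Hom C C) F (fun f h => k h *: f).
  - by move=> h a f1 f2 /=; rewrite scalerDr !scalerA mulrC.
  - by move=> f1 a h h'; rewrite linearP scalerDl scalerA.
  have := uE f (homothety C 1); rewrite f0 linear0.
  by rewrite -[homothety C 1]/(linmap homothety_lin 1) hk scale1r.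
have [z <-] := bij_surj bij_ht y.
elim/tensor_ind: z => [|f h z [x xz]]; first by exists 0; rewrite !linear0.
exists (k h *: f + x); rewrite linearD xz linearD; congr (_ + _).
rewrite unit_mapE tpureZl -tpureZr; congr (hom_tensor _ _ _ (tpure _ _)).
rewrite -[RHS]kh -[homothety C 1]/(linmap homothety_lin 1) -linearZZ.
by congr (linmap homothety_lin _); exact: mulr1.
Qed.

Lemma hom_postcomp_iso X Y (e : {linear X -> Y}) :
  bijective e -> bijective (hom_postcomp C e).
Proof.
case/bij_linear_inv => e' [ee' e'e].
by exists (hom_postcomp C e') => h; apply: HomP => c; [exact: ee'|exact: e'e].
Qed.

Lemma FC_hom_flat X : FC C X -> flat (Hom C X).
Proof.
move=> [F [flatF [e bij_e]]]; apply: (flat_iso _ flatF).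
apply: (isomorphic_trans (V := Hom C (tensor F C))).
  by exists (hom_postcomp C e); exact: hom_postcomp_iso.
by apply: isomorphic_sym; exists (unit_map F); exact: unit_map_bij.
Qed.

Lemma eval_tensor_exists X N :
  exists t : {linear tensor (Hom C X) (tensor C N) -> tensor X N},
    forall h y, t (tpure h y) = tensor_map (h : {linear C -> X}) (idl N) y.
Proof.
apply: tensor_lift => [y a h h'|h a y y']; last exact: linearP.
elim/tensor_ind: y => [|c n y IHy]; first by rewrite /= !linear0 ?scaler0 ?addr0.
rewrite !linearD /= IHy !tensor_mapE addrACA; congr (_ + _).
by rewrite -tpureZl -tpureDl.
Qed.

(** The map [h (x) (c (x) n) |-> h c (x) n]. *)
Definition eval_tensor X N : {linear tensor (Hom C X) (tensor C N) -> tensor X N} :=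
  sval (cid (eval_tensor_exists X N)).

Lemma eval_tensorE X N h y :
  eval_tensor X N (tpure h y) = tensor_map (h : {linear C -> X}) (idl N) y.
Proof. exact: (svalP (cid (eval_tensor_exists X N))). Qed.

Lemma eval_tensor_nat X Y N (g : {linear X -> Y}) z :
  eval_tensor Y N (tensor_map (hom_postcomp C g) (idl (tensor C N)) z) =
  tensor_map g (idl N) (eval_tensor X N z).
Proof.
elim/tensor_ind: z => [|h y z IHz]; first by rewrite !linear0.
rewrite !linearD /= IHz tensor_mapE !eval_tensorE; congr (_ + _).
by symmetry; apply: tensor_map_comp.
Qed.

Fact tensor_assoc_lin N (n : N) : linear (fun c : C => tpure c n).
Proof. by move=> a c c'; rewrite tpureDl tpureZl. Qed.

(** The composite is the associativity isomorphism
    [f (x) (c (x) n) |-> (f (x) c) (x) n]. *)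
Lemma tensor_assoc_bij F N : bijective (fun z : tensor F (tensor C N) =>
  eval_tensor (tensor F C) N (tensor_map (unit_map F) (idl (tensor C N)) z)).
Proof.
have [||a aE] := @tensor_lift R (tensor F C) N (tensor F (tensor C N))
    (fun x n => tensor_map (idl F) (linmap (tensor_assoc_lin n)) x).
- by move=> n a x y; rewrite linearP.
- move=> x a n n'; elim/tensor_ind: x => [|f c x IHx].
    by rewrite !linear0 ?scaler0 ?addr0.
  rewrite !linearD /= IHx !tensor_mapE addrACA; congr (_ + _).
  by rewrite -tpureZr -tpureDr; congr tpure; rewrite /= tpureDr tpureZr.
have tE f c n : eval_tensor (tensor F C) N (tensor_map (unit_map F) (idl _)
    (tpure f (tpure c n))) = tpure (tpure f c) n.
  by rewrite tensor_mapE eval_tensorE tensor_mapE.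
exists a => z.
  elim/tensor_ind: z => [|f y z IHz]; first by rewrite !linear0.
  rewrite !linearD /= IHz; congr (_ + _); rewrite tensor_mapE eval_tensorE.
  elim/tensor_ind: y {z IHz} => [|c n y IHy].
    by rewrite linear0 linear0 tpure0r.
  by rewrite linearD linearD IHy tpureDr /= tensor_mapE aE tensor_mapE.
elim/tensor_ind: z => [|x n z IHz]; first by rewrite !linear0.
rewrite !linearD /= IHz; congr (_ + _); rewrite aE.
elim/tensor_ind: x {z IHz} => [|f c x IHx].
  by rewrite !linear0 tpure0l.
by rewrite !linearD /= IHx tpureDl [tensor_map (idl F) _ _]tensor_mapE tE.
Qed.

(** By naturality [X] may be taken to be [F (x) C], where precomposing with the
    isomorphism [F = Hom(C, F (x) C)] gives the associativity isomorphism. *)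
Lemma eval_tensor_bij X N : FC C X -> bijective (eval_tensor X N).
Proof.
move=> [F [flatF [e bij_e]]].
have bij_u : bijective (tensor_map (unit_map F) (idl (tensor C N))).
  by apply: tensor_map_bij; [exact: unit_map_bij|exists id].
have bij_F : bijective (eval_tensor (tensor F C) N).
  have [u' u'K uK] := bij_u.
  apply: (eq_bij (bij_comp (tensor_assoc_bij F N) (Bijective uK u'K))) => z.
  by rewrite /= uK.
have bij_he : bijective (tensor_map (hom_postcomp C e) (idl (tensor C N))).
  by apply: tensor_map_bij; [exact: hom_postcomp_iso|exists id].
have [e' e'K eK] : bijective (tensor_map e (idl N)).
  by apply: tensor_map_bij => //; exists id.
have e'_bij : bijective e' by exists (tensor_map e (idl N)).
apply: (eq_bij (bij_comp e'_bij (bij_comp bij_F bij_he))) => z.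
by rewrite /= [eval_tensor _ _ _]eval_tensor_nat e'K.
Qed.

(** The common shape of proper [P_C]- and [F_C]-resolutions; only the test object
    [C] of properness is retained. *)
Definition C_resolution M (X : augmented M) : Prop :=
  (forall n, FC C (X n)) /\ exact_complex (hom_complex C (augment X)).

Section HomAugmented.
Variables (M : lmodType R) (X : augmented M).

Fact hom_augmented_mapd x :
  hom_postcomp C (aug_map X) (complex_d (hom_complex C X) 0 x) = 0.
Proof. by apply: HomP => c; exact: aug_mapd. Qed.

Definition hom_augmented : augmented (Hom C M) :=
  @Augmented R (Hom C M) (hom_complex C X) (hom_postcomp C (aug_map X))
    hom_augmented_mapd.

Lemma hom_augmented_resolution : C_resolution X -> flat_resolution hom_augmented.
Proof.
move=> [FCX exX]; split=> [n|]; first exact: FC_hom_flat.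
apply/exact_complexP => n v dv; have := (exact_complexP _).1 exX n.
by case: n v dv => [|[|n]] v dv; apply.
Qed.

(** The chain isomorphism [Hom(C, X) (x) (C (x) N) = X (x) N]. *)
Lemma hom_augmented_homology N i : C_resolution X ->
  isomorphic (complex_homology (tensor_complex hom_augmented (tensor C N)) i)
             (complex_homology (tensor_complex X N) i).
Proof.
move=> [FCX _]; have bij_t n := eval_tensor_bij N (FCX n).
have t_nat n z : eval_tensor (X n) N
    (complex_d (tensor_complex hom_augmented (tensor C N)) n z) =
    complex_d (tensor_complex X N) n (eval_tensor (X n.+1) N z).
  exact: eval_tensor_nat.
apply: (homology_iso_chain (bij_t i.+1) (bij_t i) (bij_t i.-1)) => z.
  exact: t_nat.
by case: i z => [|i] z; [exact: linear0|exact: t_nat].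
Qed.

End HomAugmented.

Lemma C_resolution_independence M (X X' : augmented M) N i :
    C_resolution X -> C_resolution X' ->
  isomorphic (complex_homology (tensor_complex X N) i)
             (complex_homology (tensor_complex X' N) i).
Proof.
move=> resX resX'; apply: isomorphic_trans (hom_augmented_homology N i resX').
apply: isomorphic_trans (isomorphic_sym (hom_augmented_homology N i resX)) _.
by apply: flat_resolution_independence; exact: hom_augmented_resolution.
Qed.

End RelativeResolution.

(** * Base change *)

Section BaseChange.
Variables (R S : comPzRingType) (phi : {rmorphism R -> S}).
Local Notation SR := (restrict phi S^o).
Implicit Types (M N U V F X Y : lmodType R) (W B : lmodType S).

Lemma extend_scaleE M (s s' : S) (m : M) :
  s *: (tpure (s' : SR) m : extend phi M) = tpure (s * s' : SR) m.
Proof. exact: tensor_map_pure. Qed.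

(** The two [R]-module structures on [S (x) M], one from the tensor product and one
    restricted along [phi], agree only up to this equation. *)
Lemma extend_scaleR M (r : R) (x : tensor SR M) :
  r *: x = phi r *: (x : extend phi M) :> tensor SR M.
Proof.
elim/tensor_ind: x => [|s m x IHx].
  by rewrite scaler0 -[LHS](scaler0 (extend phi M) (phi r)).
rewrite scalerDr IHx -tpureZl.
by rewrite [RHS](@scalerDr _ (extend phi M)) [X in _ = X + _]extend_scaleE.
Qed.

Fact extend_unit_lin M :
  linear ((fun m => tpure (1 : SR) m) : M -> restrict phi (extend phi M)).
Proof.
move=> r m m'; rewrite tpureDr tpureZr extend_scaleR; by [].
Qed.

Definition extend_unit M : {linear M -> restrict phi (extend phi M)} :=
  linmap (@extend_unit_lin M).

Lemma extend_pureE M (s : S) (m : M) :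
  tpure (s : SR) m = s *: (extend_unit M m : extend phi M).
Proof. by rewrite [RHS]extend_scaleE mulr1. Qed.

Lemma extend_unitP M (r : R) (m m' : M) :
  extend_unit M (r *: m + m') =
  phi r *: (extend_unit M m : extend phi M) + extend_unit M m' :> extend phi M.
Proof. exact: linearP. Qed.

Lemma restrict_scaleE W (r : R) (w : W) :
  r *: (w : restrict phi W) = phi r *: w :> W.
Proof. by []. Qed.

Lemma extend_ind M (P : extend phi M -> Prop) :
    P 0 -> (forall s m x, P x -> P (s *: (extend_unit M m : extend phi M) + x)) ->
  forall x, P x.
Proof.
move=> P0 PD; apply: tensor_ind => // s m x Px.
by rewrite extend_pureE; exact: PD.
Qed.

Lemma extend_linear_eq M W (f g : {linear extend phi M -> W}) :
  (forall m, f (extend_unit M m) = g (extend_unit M m)) -> f =1 g.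
Proof.
move=> fg; elim/extend_ind => [|s m x IHx]; first by rewrite !linear0.
by rewrite !linearP IHx fg.
Qed.

Lemma extend_lift_exists M W (g : {linear M -> restrict phi W}) :
  exists h : {linear extend phi M -> W}, forall m, h (extend_unit M m) = g m.
Proof.
have [||f fE] := @tensor_lift R SR M (restrict phi W)
    (fun s m => (s : S) *: (g m : W)).
- by move=> m r s s'; rewrite scalerDl -scalerA.
- move=> s r m m'; rewrite linearP scalerDr; congr (_ + _).
  by rewrite scalerA mulrC -scalerA.
have f_lin : linear (f : extend phi M -> W).
  move=> s x y; rewrite -[LHS]/(f ((s *: x : extend phi M) + y)) linearD; congr (_ + _).
  elim/tensor_ind: x => [|s' m x IHx].
    by rewrite [X in f X](@scaler0 _ (extend phi M) s) linear0 scaler0.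
  rewrite [X in f X](@scalerDr _ (extend phi M)) !linearD.
  rewrite [X in _ + X]IHx [X in f X + _]extend_scaleE !fE.
  by congr (_ + _); rewrite /= scalerA.
by exists (linmap f_lin) => m; rewrite /= fE scale1r.
Qed.

Definition extend_lift M W (g : {linear M -> restrict phi W}) :
  {linear extend phi M -> W} := sval (cid (extend_lift_exists g)).

Lemma extend_liftE M W (g : {linear M -> restrict phi W}) m :
  extend_lift g (extend_unit M m) = g m.
Proof. exact: (svalP (cid (extend_lift_exists g))). Qed.

Fact extend_map_lin M N (f : {linear M -> N}) :
  linear (tensor_map (idl SR) f : extend phi M -> extend phi N).
Proof.
move=> s x y; rewrite -[LHS]/(tensor_map (idl SR) f ((s *: x : extend phi M) + y)).
rewrite linearD; congr (_ + _).
exact: tensor_map_square.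
Qed.

Definition extend_map M N (f : {linear M -> N}) :
  {linear extend phi M -> extend phi N} := linmap (extend_map_lin f).

Lemma extend_mapE M N (f : {linear M -> N}) m :
  extend_map f (extend_unit M m) = extend_unit N (f m).
Proof. exact: tensor_map_pure. Qed.

Lemma extend_map_comp M N U (f : {linear M -> N}) (g : {linear N -> U})
    (h : {linear M -> U}) :
  (forall x, g (f x) = h x) -> forall x, extend_map g (extend_map f x) = extend_map h x.
Proof. by move=> gf x; apply: tensor_map_comp. Qed.

Lemma extend_map_id M (f : {linear M -> M}) : f =1 id -> extend_map f =1 id.
Proof. by move=> f1; apply: tensor_map_id. Qed.

Lemma extend_map0 M N x : extend_map (\0 : M -> N) x = 0.
Proof.
by apply: (extend_linear_eq (g := \0)) => m; rewrite extend_mapE linear0.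
Qed.

Lemma extend_iso M N : isomorphic M N -> isomorphic (extend phi M) (extend phi N).
Proof.
case=> f /bij_linear_inv[g [fg gf]]; exists (extend_map f); exists (extend_map g) => x.
  by rewrite (extend_map_comp (h := idl M)) // extend_map_id.
by rewrite (extend_map_comp (h := idl N)) // extend_map_id.
Qed.

Local Notation ext1 x := (extend_unit _ x : extend phi _).

(** ** Extension of scalars and tensor products *)

Section TensorExtend.
Variables X N : lmodType R.
Local Notation XN := (tensor X N).
Local Notation EXEN := (tensor (extend phi X) (extend phi N)).

Lemma extend_tensor_exists : exists g : {linear extend phi XN -> EXEN},
  forall x n, g (extend_unit _ (tpure x n)) = tpure (ext1 x) (ext1 n).
Proof.
have [||g gE] := @tensor_lift R X N (restrict phi EXEN)
  (fun x n => tpure (ext1 x) (ext1 n)).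
- by move=> n a x x'; rewrite linearP tpureDl tpureZl.
- by move=> x a n n'; rewrite linearP tpureDr tpureZr.
by exists (extend_lift g) => x n; rewrite extend_liftE gE.
Qed.

Definition extend_tensor : {linear extend phi XN -> EXEN} :=
  sval (cid extend_tensor_exists).

Lemma extend_tensorE x n :
  extend_tensor (extend_unit _ (tpure x n)) = tpure (ext1 x) (ext1 n).
Proof. exact: (svalP (cid extend_tensor_exists)). Qed.

Fact pure_right_lin (x : X) : linear (fun n : N => tpure x n).
Proof. by move=> a n n'; rewrite tpureDr tpureZr. Qed.

Lemma extend_tensor_inv_lin (v : extend phi N) : linear
  ((fun x => extend_map (linmap (pure_right_lin x)) v) : X -> restrict phi (extend phi XN)).
Proof.
move=> a x x'; elim/extend_ind: v => [|s n v IHv].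
  by rewrite !linear0 ?scaler0 ?addr0.
rewrite [LHS]linearP [X in _ = _ *: X + _]linearP [X in _ = _ + X]linearP.
rewrite IHv !extend_mapE scalerDr addrACA; congr (_ + _).
have -> : linmap (pure_right_lin (a *: x + x')) n = a *: tpure x n + tpure x' n.
  by rewrite /= tpureDl tpureZl.
by rewrite [extend_unit _ _]extend_unitP scalerDr restrict_scaleE !scalerA mulrC.
Qed.

(** The inverse sends [(s (x) x) (x) v] to [s] times the image of [v] under the map
    induced by [n |-> x (x) n]. *)
Lemma extend_tensor_bij : bijective extend_tensor.
Proof.
pose L v := extend_lift (linmap (extend_tensor_inv_lin v)).
have LE v x : L v (ext1 x) = extend_map (linmap (pure_right_lin x)) v.
  exact: extend_liftE.
have [||h hE] := @tensor_lift S (extend phi X) (extend phi N) (extend phi XN)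
    (fun u v => L v u).
- by move=> v; exact: linearP.
- move=> u a v v'; elim/extend_ind: u => [|s x u IHu].
    by rewrite !linear0 ?scaler0 ?addr0.
  rewrite [LHS]linearP [X in _ = _ *: X + _]linearP [X in _ = _ + X]linearP.
  rewrite IHu !LE linearP !scalerDr addrACA; congr (_ + _ + _).
  by rewrite !scalerA mulrC.
have hK x n : h (tpure (ext1 x) (ext1 n)) = ext1 (tpure x n).
  by rewrite hE LE extend_mapE.
exists h => z.
  apply: (extend_linear_eq (f := h \o extend_tensor) (g := idfun)) => {}z.
  elim/tensor_ind: z => [|x n z IHz]; first by rewrite !linear0.
  by rewrite !linearD IHz; congr (_ + _); rewrite /= extend_tensorE hK.
elim/tensor_ind: z => [|u v z IHz]; first by rewrite !linear0.
rewrite !linearD IHz; congr (_ + _).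
elim/extend_ind: u => [|s x u IHu]; first by rewrite tpure0l !linear0.
rewrite tpureDl !linearD IHu; congr (_ + _).
rewrite tpureZl !linearZZ; congr (_ *: _).
elim/extend_ind: v {z IHz u IHu} => [|s' n v IHv]; first by rewrite tpure0r !linear0.
rewrite tpureDr !linearD IHv; congr (_ + _).
by rewrite tpureZr !linearZZ hK extend_tensorE.
Qed.

End TensorExtend.

Lemma extend_tensor_nat X Y N (g : {linear X -> Y}) z :
  extend_tensor Y N (extend_map (tensor_map g (idl N)) z) =
  tensor_map (extend_map g) (idl (extend phi N)) (extend_tensor X N z).
Proof.
apply: (extend_linear_eq
  (f := extend_tensor Y N \o extend_map (tensor_map g (idl N)))
  (g := tensor_map (extend_map g) (idl (extend phi N)) \o extend_tensor X N)) => {}z.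
elim/tensor_ind: z => [|x n z IHz]; first by rewrite !linear0.
rewrite !linearD IHz; congr (_ + _).
rewrite /= extend_mapE [X in extend_unit _ X]tensor_mapE extend_tensorE.
by rewrite [RHS](congr1 _ (extend_tensorE x n)) tensor_mapE !extend_mapE.
Qed.

(** ** Flatness of an extended module *)

Section FlatExtend.
Variables (F : lmodType R).

(** [F (x)_R B] with [S] acting on [B].  It contains [(S (x)_R F) (x)_S B], naturally
    in [B], which reduces flatness over [S] to flatness over [R]. *)
Definition tensor_over B : Type := tensor F (restrict phi B).

Section TensorOver.
Variable B : lmodType S.
Local Notation T := (tensor_over B).

HB.instance Definition _ := GRing.Zmodule.copy T (tensor F (restrict phi B)).

Definition tensor_over_scale (s : S) (x : T) : T :=
  tensor_map (idl F)
    (restrict_mul s : {linear restrict phi B -> restrict phi B}) x.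

Let tensor_over_scale_pure s f b (x : T) :
  tensor_over_scale s (tpure f (b : restrict phi B) + x) =
  (tpure f (s *: b : restrict phi B) : T) + tensor_over_scale s x.
Proof. by rewrite /tensor_over_scale linearD /= tensor_mapE. Qed.

Let tensor_over_scale0 s : tensor_over_scale s 0 = 0.
Proof. by rewrite /tensor_over_scale linear0. Qed.

Fact tensor_over_scaleA s s' x :
  tensor_over_scale s (tensor_over_scale s' x) = tensor_over_scale (s * s') x.
Proof.
elim/tensor_ind: x => [|f b x IHx]; first by rewrite !tensor_over_scale0.
by rewrite !tensor_over_scale_pure IHx scalerA.
Qed.
Fact tensor_over_scale1 : left_id 1 tensor_over_scale.
Proof.
elim/tensor_ind => [|f b x IHx]; first by rewrite tensor_over_scale0.
by rewrite tensor_over_scale_pure IHx scale1r.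
Qed.
Fact tensor_over_scaleDr : right_distributive tensor_over_scale +%R.
Proof. by move=> s x y; rewrite /tensor_over_scale linearD. Qed.
Fact tensor_over_scaleDl x : {morph tensor_over_scale^~ x : s s' / s + s'}.
Proof.
move=> s s'; elim/tensor_ind: x => [|f b x IHx].
  by rewrite !tensor_over_scale0 addr0.
by rewrite !tensor_over_scale_pure IHx addrACA scalerDl -tpureDr.
Qed.
HB.instance Definition _ := GRing.Zmodule_isLmodule.Build S T
  tensor_over_scaleA tensor_over_scale1 tensor_over_scaleDr tensor_over_scaleDl.

Lemma tensor_over_scaleE (s : S) f (b : B) :
  s *: (tpure f (b : restrict phi B) : T) = tpure f (s *: b : restrict phi B).
Proof. exact: tensor_map_pure. Qed.

Lemma tensor_over_scaleR (r : R) (x : tensor F (restrict phi B)) :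
  r *: x = phi r *: (x : T) :> T.
Proof.
elim/tensor_ind: x => [|f b x IHx].
  by rewrite scaler0 -[LHS](@scaler0 _ T (phi r)).
rewrite scalerDr IHx -tpureZr.
by rewrite [RHS](@scalerDr _ T) [X in _ = X + _]tensor_over_scaleE.
Qed.

Fact tensor_over_pure_lin (b : B) :
  linear ((fun f => tpure f (b : restrict phi B)) : F -> restrict phi T).
Proof. by move=> r f f'; rewrite tpureDl tpureZl tensor_over_scaleR. Qed.

Lemma tensor_over_exists : exists t : {linear tensor (extend phi F) B -> T},
  forall f b, t (tpure (ext1 f) b) = tpure f (b : restrict phi B).
Proof.
pose L b := extend_lift (linmap (tensor_over_pure_lin b)).
have LE b f : L b (ext1 f) = tpure f (b : restrict phi B) by exact: extend_liftE.
have [||t tE] := @tensor_lift S (extend phi F) B T (fun u b => L b u).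
- by move=> b; exact: linearP.
- move=> u a b b'; elim/extend_ind: u => [|s f u IHu].
    by rewrite !linear0 ?scaler0 ?addr0.
  rewrite [LHS]linearP [X in _ = _ *: X + _]linearP [X in _ = _ + X]linearP.
  rewrite IHu !LE scalerDr addrACA; congr (_ + _).
  rewrite !tensor_over_scaleE scalerDr [LHS]tpureDr; congr (_ + _).
  by rewrite !scalerA mulrC.
by exists t => f b; rewrite tE LE.
Qed.

Definition tensor_over_map : {linear tensor (extend phi F) B -> T} :=
  sval (cid tensor_over_exists).

Lemma tensor_over_mapE f b :
  tensor_over_map (tpure (ext1 f) b) = tpure f (b : restrict phi B).
Proof. exact: (svalP (cid tensor_over_exists)). Qed.

Lemma tensor_over_map_inj : injective tensor_over_map.
Proof.
have [||t tE] := @tensor_lift R F (restrict phi B)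
  (restrict phi (tensor (extend phi F) B)) (fun f b => tpure (ext1 f) (b : B)).
- by move=> b r f f'; rewrite [extend_unit _ _]extend_unitP tpureDl tpureZl.
- by move=> f r b b'; rewrite [LHS]tpureDr restrict_scaleE tpureZr.
apply: (can_inj (g := t)); elim/tensor_ind => [|u b z IHz].
  by rewrite !linear0.
rewrite !linearD IHz; congr (_ + _).
elim/extend_ind: u {z IHz} => [|s f u IHu].
  by rewrite tpure0l !linear0.
rewrite tpureDl !linearD IHu; congr (_ + _).
by rewrite tpureZl -tpureZr tensor_over_mapE tE.
Qed.

End TensorOver.

Lemma extend_flat : flat F -> flat (extend phi F).
Proof.
move=> flatF U V g g_inj.
have gR_lin : linear (g : restrict phi U -> restrict phi V).
  by move=> r u u'; rewrite [LHS]linearD [X in X + _ = _]linearZZ.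
have g_nat z : tensor_over_map V (tensor_map (idl (extend phi F)) g z) =
    tensor_map (idl F) (linmap gR_lin) (tensor_over_map U z).
  elim/tensor_ind: z => [|u b z IHz]; first by rewrite !linear0.
  rewrite !linearD IHz; congr (_ + _); rewrite /= tensor_mapE.
  elim/extend_ind: u {z IHz} => [|s f u IHu].
    by rewrite !tpure0l !linear0.
  rewrite !tpureDl !linearD IHu; congr (_ + _).
  rewrite !tpureZl -!tpureZr !tensor_over_mapE [RHS]tensor_mapE /=.
  by rewrite linearZZ.
have bij_T := flatF _ _ (linmap gR_lin) g_inj.
move=> z z' /(congr1 (tensor_over_map V)); rewrite !g_nat => /bij_T.
exact: tensor_over_map_inj.
Qed.

End FlatExtend.
End BaseChange.

(** * Flat base change *)

Section FlatBaseChange.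
Variables (R S : comPzRingType) (phi : {rmorphism R -> S}).
Hypothesis flat_phi : flat_morphism phi.
Local Notation SR := (restrict phi S^o).
Local Notation ext1 x := (extend_unit phi _ x : extend phi _).
Implicit Types (M N U V W F X Y : lmodType R).

Lemma extend_exact U V W (f : {linear U -> V}) (g : {linear V -> W}) :
    (forall v, g v = 0 -> exists u, f u = v) ->
  forall z, extend_map phi g z = 0 -> exists y, extend_map phi f y = z.
Proof. exact: flat_exact. Qed.

(** With [Z] the cycles, a cycle of the extended complex and an element of the extended
    homology correspond when they come from the same element of [S (x) Z]. *)
Lemma extend_homology U V W (f : {linear U -> V}) (g : {linear V -> W}) :
    (forall u, g (f u) = 0) ->
  isomorphic (extend phi (homology f g)) (homology (extend_map phi f) (extend_map phi g)).
Proof.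
move=> gf; apply: isomorphic_sym.
pose Z := cycles g; pose i : {linear Z -> V} := submodule_incl (ker_pred g).
pose p : {linear Z -> homology f g} := quotmod_pi (@boundary_pred _ _ _ _ f g).
have i_exact v : g v = 0 -> exists z, i z = v.
  by move=> gv; apply/submodule_inclP; rewrite inE gv.
have gi z : g (i z) = 0 by have := submodule_valP z; rewrite inE => /eqP.
have ei_inj : injective (extend_map phi i).
  exact: (flat_phi (@submodule_incl_inj _ _ (ker_pred g))).
have [|f' if'] := corestrict (I := ker_pred g) (f := f).
  by move=> u; rewrite inE gf.
have p_surj h : exists z, p z = h.
  by have [z ->] := quotmod_pi_surj h; exists z.
have p_exact z : p z = 0 -> exists u, f' u = z.
  rewrite -(linear0 p) => /quotmod_piP; rewrite subr0 => /asboolP[u fu].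
  by exists u; apply: (@submodule_incl_inj _ _ (ker_pred g)); rewrite if' fu.
have pf' u : p (f' u) = 0.
  rewrite -(linear0 p); apply/quotmod_piP; rewrite subr0; apply/asboolP; exists u.
  exact: esym (if' u).
apply: (homology_rel_iso (P := fun v h =>
  exists z, extend_map phi i z = v /\ extend_map phi p z = h)).
- move=> a _ _ _ _ [z [<- <-]] [z' [<- <-]]; exists (a *: z + z').
  by rewrite !linearP.
- move=> v /(extend_exact i_exact)[z zv].
  by exists (extend_map phi p z), z.
- move=> h; have [z zh] := tensor_map_surj (T := SR) p_surj h.
  exists (extend_map phi i z); split; last by exists z.
  by rewrite (extend_map_comp (h := \0)) // extend_map0.
- move=> _ _ _ [z [<- <-]]; split=> [pz|[u fu]].
    have [u uz] := tensor_right_exact (T := SR) p_exact p_surj pz.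
    by exists u; rewrite -uz [RHS](extend_map_comp (h := f)).
  have -> : z = extend_map phi f' u.
    by apply: ei_inj; rewrite -fu (extend_map_comp (h := f)).
  by rewrite (extend_map_comp (h := \0)) // extend_map0.
Qed.

Section Semidualizing.
Variable C : lmodType R.
Hypotheses (fpC : finitely_presented C) (homothC : bijective (@homothety R C)).
Local Notation C' := (extend phi C).

Lemma extend_finitely_generated M :
  finitely_generated M -> finitely_generated (extend phi M).
Proof.
move=> [s sP]; exists [seq ext1 m | m <- s] => x; apply/spanP.
have [e0 eD] := span_closed [seq ext1 m | m <- s].
elim/extend_ind: x => [|a m x IHx]; first exact: e0.
apply: eD => //; have /spanP := sP m.
elim: (s) m => [|u t IHt] m /=; first by move=> ->; exact: (linear0 (extend_unit phi M)).
move=> [r [z [/IHt tz ->]]]; exists (phi r), (ext1 z); split=> //.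
exact: extend_unitP.
Qed.

(** Together with [hom_restrict] this is the adjunction
    [Hom_S(S (x) C, S (x) V) = Hom_R(C, S (x) V)], which brings the target into the
    form that [hom_tensor] describes. *)
Lemma extend_hom V (h : Hom C (tensor SR V)) :
  exists h' : {linear C' -> extend phi V},
    forall c, h' (ext1 c) = (h : {linear _ -> _}) c.
Proof.
have h_lin : linear ((h : {linear _ -> _}) : C -> restrict phi (extend phi V)).
  by move=> r c c'; rewrite linearP extend_scaleR.
by exists (extend_lift (linmap h_lin)) => c; rewrite extend_liftE.
Qed.

Lemma hom_restrict V (h : {linear C' -> extend phi V}) :
  exists h' : Hom C (tensor SR V),
    forall c, (h' : {linear _ -> _}) c = h (ext1 c).
Proof.
have h_lin : linear ((fun c => h (ext1 c)) : C -> tensor SR V).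
  move=> r c c'; rewrite extend_scaleR [extend_unit _ _ _]extend_unitP.
  exact: linearP.
by exists (linmap h_lin).
Qed.

(** [Hom_S(S (x) C, S (x) C) = Hom_R(C, S (x) C) = S], the last step being
    [unit_map_bij] for the flat [R]-module [S]. *)
Lemma extend_homothety : bijective (@homothety S C').
Proof.
have bij_u := unit_map_bij fpC homothC flat_phi.
have uE (s : S) c : (unit_map C SR s : {linear _ -> _}) c = s *: ext1 c.
  by rewrite -extend_pureE.
have hE (s : S) x : (homothety C' s : {linear C' -> C'}) x = s *: x by [].
apply: inj_surj_bij => [s s' ss'|h].
  suff /(bij_inj bij_u) : unit_map C SR s = unit_map C SR s' by [].
  by apply: HomP => c; rewrite (uE s) (uE s') -(hE s) -(hE s') ss'.
have [h' h'E] := hom_restrict h; have [s sE] := bij_surj bij_u h'.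
exists s; apply: HomP; apply: extend_linear_eq => c.
by rewrite -h'E -sE uE.
Qed.

(** [Hom_S(S (x) C, S (x) V) = S (x) Hom_R(C, V)] for [C] finitely presented, so
    flatness carries exactness of [Hom(C, -)] over. *)
Lemma extend_hom_exact U V W (f : {linear U -> V}) (g : {linear V -> W}) :
    (forall h : Hom C V, hom_postcomp C g h = 0 -> exists k, hom_postcomp C f k = h) ->
  forall h : {linear C' -> extend phi V}, (forall x, extend_map phi g (h x) = 0) ->
  exists k : {linear C' -> extend phi U}, forall x, extend_map phi f (k x) = h x.
Proof.
move=> fg_exact h gh; have [h' h'E] := hom_restrict h.
have [z zh'] := bij_surj (hom_tensor_bij V flat_phi fpC) h'.
have [|y yz] := flat_exact flat_phi fg_exact (z := z).
  apply: (bij_inj (hom_tensor_bij W flat_phi fpC)).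
  rewrite hom_tensor_postcomp zh' linear0; apply: HomP => c.
  by rewrite /= h'E; exact: gh.
have [k kE] := extend_hom (hom_tensor SR C U y); exists k.
apply: (extend_linear_eq (f := extend_map phi f \o k)) => c.
rewrite -h'E -zh' -yz hom_tensor_postcomp /=.
by rewrite kE.
Qed.

Lemma extend_FC X : FC C X -> FC C' (extend phi X).
Proof.
move=> [F [flatF XF]]; exists (extend phi F); split; first exact: extend_flat.
apply: isomorphic_trans (extend_iso phi XF) _.
by exists (extend_tensor phi F C); exact: extend_tensor_bij.
Qed.

Section Complex.
Variables (M : lmodType R) (X : augmented M).

Fact extend_complex_dd n x :
  extend_map phi (complex_d X n) (extend_map phi (complex_d X n.+1) x) = 0.
Proof.
by rewrite (extend_map_comp (h := \0)) ?extend_map0 //; exact: complex_dd.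
Qed.

Fact extend_aug_mapd x :
  extend_map phi (aug_map X) (extend_map phi (complex_d X 0) x) = 0.
Proof.
by rewrite (extend_map_comp (h := \0)) ?extend_map0 //; exact: aug_mapd.
Qed.

Definition extend_augmented : augmented (extend phi M) :=
  @Augmented S (extend phi M) (Complex extend_complex_dd)
    (extend_map phi (aug_map X)) extend_aug_mapd.

Lemma extend_C_resolution : C_resolution C X -> C_resolution C' extend_augmented.
Proof.
move=> [FCX exX]; split=> [n|]; first exact: extend_FC.
have ex := (exact_complexP _).1 exX.
have key U V W (f : {linear U -> V}) (g : {linear V -> W}) (h : Hom C' (extend phi V)) :
    (forall k : Hom C V, hom_postcomp C g k = 0 -> exists k', hom_postcomp C f k' = k) ->
    hom_postcomp C' (extend_map phi g) h = 0 ->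
    exists k, hom_postcomp C' (extend_map phi f) k = h.
  move=> fg_exact gh; have [|k kE] := extend_hom_exact fg_exact (h := h).
    move=> x; exact: (congr1 (fun k : Hom _ _ => (k : {linear _ -> _}) x) gh).
  by exists k; apply: HomP.
apply/exact_complexP => -[|[|n]] h dh.
(* Nothing leaves degree 0, where exactness is surjectivity onto [Hom(C, M)]. *)
- apply: (key _ _ _ _ (\0 : M -> M)) => [k _|]; first exact: (ex 0%N).
  by apply: HomP => x; rewrite /= extend_map0.
- by apply: key dh; exact: (ex 1%N).
- by apply: key dh; exact: (ex n.+2).
Qed.

Lemma extend_tensor_homology N i :
  isomorphic (complex_homology (tensor_complex extend_augmented (extend phi N)) i)
             (extend phi (complex_homology (tensor_complex X N) i)).
Proof.
apply: isomorphic_sym.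
apply: isomorphic_trans (extend_homology _) _.
  by case: i => [|i] x //; exact: (@tensor_complex_dd _ X N).
apply: (homology_iso_chain (extend_tensor_bij phi (X i.+1) N)
  (extend_tensor_bij phi (X i) N) (extend_tensor_bij phi (X i.-1) N)) => z.
  exact: extend_tensor_nat.
case: i z => [|i] z; last exact: extend_tensor_nat.
by rewrite /= extend_map0 linear0.
Qed.

End Complex.
End Semidualizing.
End FlatBaseChange.

Lemma relTor_base_change (R S : comPzRingType) (C M N : lmodType R)
    (phi : {rmorphism R -> S}) (X : augmented M) (X' : augmented (extend phi M)) i :
    noetherian R -> noetherian S -> semidualizing C -> flat_morphism phi ->
    C_resolution C X -> C_resolution (extend phi C) X' ->
  isomorphic (complex_homology (tensor_complex X' (extend phi N)) i)
             (extend phi (complex_homology (tensor_complex X N) i)).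
Proof.
move=> noethR noethS [fgC homothC _] flat_phi resX resX'.
have fpC := noetherian_presented noethR fgC.
have fpC' := noetherian_presented noethS (extend_finitely_generated phi fgC).
have homothC' := extend_homothety flat_phi fpC homothC.
have resEX := extend_C_resolution flat_phi fpC resX.
apply: isomorphic_trans (extend_tensor_homology flat_phi X N i).
exact: (C_resolution_independence fpC' homothC').
Qed.

Lemma proper_C_resolution (R : comPzRingType) (K : lmodType R -> Prop)
    (C M : lmodType R) (Q : proper_resolution K M) :
  K C -> (forall X, K X -> FC C X) -> C_resolution C Q.
Proof.
move=> KC KF; split=> [n|]; first by apply: KF; exact: prop_mem.
exact: prop_proper.
Qed.

Theorem proposition3p10 (R S : comPzRingType)
    (noethR : noetherian R) (noethS : noetherian S)
    (C : lmodType R) (sdC : semidualizing C) (M N : lmodType R)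
    (phi : {rmorphism R -> S}) (flat_phi : flat_morphism phi) :
  (forall (Q : proper_resolution (PC C) M)
          (Q' : proper_resolution (PC (extend phi C)) (extend phi M)) (i : nat),
     isomorphic (relTor Q' (extend phi N) i) (extend phi (relTor Q N i)))
  /\
  (forall (G : proper_resolution (FC C) M)
          (G' : proper_resolution (FC (extend phi C)) (extend phi M)) (i : nat),
     isomorphic (relTor G' (extend phi N) i) (extend phi (relTor G N i))).
Proof.
split=> Q Q' i; apply: (relTor_base_change (C := C)) => //.
- by apply: (proper_C_resolution Q); [exact: PC_self|exact: PC_FC].
- by apply: (proper_C_resolution Q'); [exact: PC_self|exact: PC_FC].
- by apply: (proper_C_resolution Q) => //; exact/PC_FC/PC_self.
- by apply: (proper_C_resolution Q') => //; exact/PC_FC/PC_self.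
Qed.
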